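(* Let $f:\Omega\to\mathbb O$ be a nonconstant slice regular function on a symmetric slice domain $\Omega\subseteq\mathbb O$. If $U$ is a symmetric open subset of $\Omega$, then $f(U)$ is open in $\mathbb O$. In particular, $f(\Omega)$ is open.
   Context: $\mathbb O$ is the real division algebra of octonions (with its Euclidean topology). $\mathbb S=\{w\in\mathbb O:w^2=-1\}$; for $I\in\mathbb S$, $\mathbb C_I=\mathbb R\oplus I\mathbb R$ and $\Omega_I=\Omega\cap\mathbb C_I$. $f:\Omega\to\mathbb O$ on a domain $\Omega\subseteq\mathbb O$ is slice regular if for every $I\in\mathbb S$ its restriction $f_I$ to $\Omega_I$ has continuous partial derivatives and $\frac12(\frac{\partial}{\partial x}+I\frac{\partial}{\partial y})f_I(x+yI)=0$ on $\Omega_I$. A set $U\subseteq\mathbb O$ is (axially) symmetric if $x+yI\in U$ (with $x,y\in\mathbb R$, $I\in\mathbb S$) implies $x+y\mathbb S\subseteq U$. A symmetric slice domain is a symmetric domain $\Omega\subseteq\mathbb O$ that intersects the real axis and such that $\Omega_I$ is a domain in $\mathbb C_I$ for every $I\in\mathbb S$. *)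

(* Defs.v *)
From HB Require Import structures.
From mathcomp Require Import all_boot all_order all_algebra.
From mathcomp Require Import all_classical all_reals all_analysis.

Set Implicit Arguments.
Unset Strict Implicit.
Unset Printing Implicit Defensive.

Import Order.TTheory GRing.Theory Num.Theory numFieldNormedType.Exports.

Local Open Scope classical_set_scope.
Local Open Scope ring_scope.

(* Cayley-Dickson doubling:
   (a, b) (c, d) = (a c - conj(d) b, d a + b conj(c)),
   conj(a, b) = (conj(a), - b). *)
Section CayleyDickson.
Variables (V : zmodType) (mul : V -> V -> V) (conj : V -> V).

Definition cd_mul (p q : V * V) : V * V :=
  (mul p.1 q.1 - mul (conj q.2) p.2, mul q.2 p.1 + mul p.2 (conj q.1)).

Definition cd_conj (p : V * V) : V * V := (conj p.1, - p.2).
End CayleyDickson.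

Definition is_domain (T : topologicalType) (A : set T) : Prop :=
  [/\ A !=set0, open A & connected A].

Section Octonions.
Variable R : realType.

Definition cplx : Type := (R^o * R^o)%type.
Definition quaternion : Type := (cplx * cplx)%type.

(* As a product of eight copies of R, this type inherits its addition, its real
   scaling and the product (hence Euclidean) topology from the library.  It also
   inherits the componentwise product [*] and unit [1], which are NOT those of
   the octonions: use [omul] and [oreal 1] instead. *)
Definition octonion : Type := (quaternion * quaternion)%type.

Definition cmul : cplx -> cplx -> cplx := cd_mul (fun a b : R^o => a * b) id.
Definition cconj : cplx -> cplx := cd_conj id.
Definition qmul : quaternion -> quaternion -> quaternion := cd_mul cmul cconj.
Definition qconj : quaternion -> quaternion := cd_conj cconj.
Definition omul : octonion -> octonion -> octonion := cd_mul qmul qconj.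

Definition oreal (x : R) : octonion := (((x, 0), 0), 0).

Definition imaginary_units : set octonion :=
  [set w | omul w w = oreal (- 1)].

(* The point x + y I, for p = (x, y); for a fixed imaginary unit I this is the
   identification of R^2 with the complex plane C_I. *)
Definition slice_point (I : octonion) (p : R^o * R^o) : octonion :=
  oreal p.1 + omul (oreal p.2) I.

(* Omega_I and f_I, both read in the real coordinates (x, y) of C_I. *)
Definition slice_set (I : octonion) (Omega : set octonion) : set (R^o * R^o) :=
  [set p | Omega (slice_point I p)].

Definition slice_fun (I : octonion) (f : octonion -> octonion) :
  R^o * R^o -> octonion := fun p => f (slice_point I p).

Definition dir_x : R^o * R^o := (1, 0).
Definition dir_y : R^o * R^o := (0, 1).

(* f is a total function, of which only the values on Omega matter: slice_set I
   Omega is open whenever Omega is, and derivatives are local. *)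
Definition slice_regular (Omega : set octonion) (f : octonion -> octonion) :
    Prop :=
  forall I, imaginary_units I ->
    [/\ forall p, slice_set I Omega p ->
          derivable (slice_fun I f) p dir_x /\ derivable (slice_fun I f) p dir_y,
        {within slice_set I Omega, continuous ('D_dir_x (slice_fun I f))},
        {within slice_set I Omega, continuous ('D_dir_y (slice_fun I f))} &
        forall p, slice_set I Omega p ->
          2^-1 *: ('D_dir_x (slice_fun I f) p
                   + omul I ('D_dir_y (slice_fun I f) p)) = 0].

Definition axially_symmetric (U : set octonion) : Prop :=
  forall (x y : R) (I J : octonion),
    imaginary_units I -> imaginary_units J ->
    U (slice_point I (x, y)) -> U (slice_point J (x, y)).

Definition symmetric_slice_domain (Omega : set octonion) : Prop :=
  [/\ is_domain Omega,
      axially_symmetric Omega,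
      exists x : R, Omega (oreal x) &
      forall I, imaginary_units I -> is_domain (slice_set I Omega)].

Definition constant_on (Omega : set octonion) (f : octonion -> octonion) :
    Prop :=
  exists c, forall w, Omega w -> f w = c.

End Octonions.

(* Main.v *)
Require Import Defs.
From HB Require Import structures.
From mathcomp Require Import all_boot all_order all_algebra.
From mathcomp Require Import all_classical all_reals all_analysis.
From mathcomp Require Import ring lra.
Set Implicit Arguments.
Unset Strict Implicit.
Unset Printing Implicit Defensive.
Import Order.TTheory GRing.Theory Num.Theory.
Import numFieldNormedType.Exports.
Local Open Scope classical_set_scope.
Local Open Scope ring_scope.

(* Write f(x + y I) = alpha(x, y) + I beta(x, y); the stem function
   F = alpha + i beta takes values in C^8 and is holomorphic, by the identity
   theorem applied to f on each slice.  Since left multiplication by an imaginary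
   unit is an isometry sending b to a vector orthogonal to b, and conversely every
   a with |a| = |b|, <a, b> = 0 is of the form - I b, the value q is attained on the
   sphere x + y S iff the complex bilinear norm
     N_q(z) = |alpha - q|^2 - |beta|^2 + 2 i <alpha - q, beta>
   vanishes at z = x + i y.  N_q is holomorphic in z and continuous in q.  If N_c
   has a non-isolated zero it vanishes identically, which on the real axis reads
   |f - c|^2 = 0 and makes f constant; otherwise the zero persists for q near c by
   Hurwitz' theorem. *)

(** * Integrals over a segment *)

(** The obstacle is that [q] is sought on a whole sphere, on which the imaginary unit varies with
    [q], and that alpha + i beta - q amounts to eight complex functions of one complex variable, to
    which Hurwitz' argument does not apply. N_q condenses them into a single holomorphic function,
    the sum of the squares of the eight; it is the stem function of the symmetrization (normal
    function) of f - q. The unit is recovered only afterwards, and axial symmetry of U places the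
    resulting point in U. The lack of associativity is harmless: what makes each slice a complex
    function is that left multiplication by a unit J squares to -1. Complex functions are pairs of
    real functions with continuous derivative. Their theory rests on two mean value identities over
    circles, obtained by differentiating under the integral sign in the radius: one yields the
    maximum principle, the other the holomorphy of the derivative. No power series occur; the order
    of a zero p is replaced by repeated division by z - p. *)

Lemma pair_continuous (X Y Z : topologicalType) (f : X -> Y) (g : X -> Z) x :
  {for x, continuous f} -> {for x, continuous g} ->
  {for x, continuous (fun y => (f y, g y))}.
Proof.
move=> cf cg.
exact: (@cvg_pair _ _ _ (nbhs x) (nbhs (f x)) (nbhs (g x)) _ _ _ f g cf cg).
Qed.

Lemma fst_continuous (X Y : topologicalType) : continuous (@fst X Y).
Proof. by move=> x; apply: cvg_fst. Qed.

Lemma snd_continuous (X Y : topologicalType) : continuous (@snd X Y).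
Proof. by move=> x; apply: cvg_snd. Qed.

Lemma comp_continuous (X Y Z : nbhsType) (f : X -> Y) (g : Y -> Z) x :
  {for x, continuous f} -> {for f x, continuous g} ->
  {for x, continuous (fun y => g (f y))}.
Proof. by move=> cf cg A gA; exact: (cf _ (cg _ gA)). Qed.

(** * Pointwise continuity of real-valued functions *)

Section RealContinuous.
Context {R : realType} {T : topologicalType}.
Implicit Types (f g : T -> R) (x : T).

Lemma real_continuousD f g x : {for x, continuous f} -> {for x, continuous g} ->
  {for x, continuous (fun y => f y + g y)}.
Proof. exact: cvgD. Qed.

Lemma real_continuousB f g x : {for x, continuous f} -> {for x, continuous g} ->
  {for x, continuous (fun y => f y - g y)}.
Proof. exact: cvgB. Qed.

Lemma real_continuousM f g x : {for x, continuous f} -> {for x, continuous g} ->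
  {for x, continuous (fun y => f y * g y)}.
Proof. exact: cvgM. Qed.

Lemma real_continuousN f x : {for x, continuous f} ->
  {for x, continuous (fun y => - f y)}.
Proof. exact: cvgN. Qed.

Lemma real_continuous_cst (c : R) x : {for x, continuous (fun _ : T => c)}.
Proof. exact: cvg_cst. Qed.

Lemma real_continuous_cos f x : {for x, continuous f} ->
  {for x, continuous (fun y => cos (f y))}.
Proof. by move=> cf; exact: (comp_continuous cf (@continuous_cos R _)). Qed.

Lemma real_continuous_sin f x : {for x, continuous f} ->
  {for x, continuous (fun y => sin (f y))}.
Proof. by move=> cf; exact: (comp_continuous cf (@continuous_sin R _)). Qed.

End RealContinuous.

Section SegmentIntegral.
Context {R : realType}.
Implicit Types (a b c e h : R) (f g F : R -> R).

Definition seg_int a b f : R := \int[lebesgue_measure]_(t in `[a, b]) f t.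

(** Continuity is two-sided even at the end points: every integrand below is continuous on a
    neighbourhood, and continuity at points composes without subspace topologies. *)
Definition seg_cont a b f := forall t, a <= t <= b -> {for t, continuous f}.

Lemma seg_cont_within a b f : seg_cont a b f -> {within `[a, b], continuous f}.
Proof.
move=> cf; apply: continuous_in_subspaceT => t; rewrite inE /= in_itv /= => tab.
exact: cf.
Qed.

Lemma seg_integrable a b f : seg_cont a b f ->
  lebesgue_measure.-integrable `[a, b] (EFin \o f).
Proof.
move=> /seg_cont_within cf.
by apply: continuous_compact_integrable => //; exact: segment_compact.
Qed.

Lemma seg_intD a b f g : seg_cont a b f -> seg_cont a b g ->
  seg_int a b (fun t => f t + g t) = seg_int a b f + seg_int a b g.
Proof. by move=> cf cg; apply: RintegralD => //; exact: seg_integrable. Qed.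

Lemma seg_intZ a b c f : seg_cont a b f ->
  seg_int a b (fun t => c * f t) = c * seg_int a b f.
Proof. by move=> cf; apply: RintegralZl => //; exact: seg_integrable. Qed.

Lemma seg_cont_cst a b c : seg_cont a b (fun=> c).
Proof. by move=> t _; exact: cst_continuous. Qed.

Lemma seg_contD a b f g : seg_cont a b f -> seg_cont a b g ->
  seg_cont a b (fun t => f t + g t).
Proof. by move=> cf cg t tab; apply: continuousD; [exact: cf|exact: cg]. Qed.

Lemma seg_contM a b f g : seg_cont a b f -> seg_cont a b g ->
  seg_cont a b (fun t => f t * g t).
Proof. by move=> cf cg t tab; apply: continuousM; [exact: cf|exact: cg]. Qed.

Lemma seg_contN a b f : seg_cont a b f -> seg_cont a b (fun t => - f t).
Proof. by move=> cf t tab; apply: continuousN; exact: cf. Qed.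

Lemma seg_intN a b f : seg_cont a b f ->
  seg_int a b (fun t => - f t) = - seg_int a b f.
Proof.
move=> cf; rewrite -mulN1r -seg_intZ//.
by apply: eq_Rintegral => t _; rewrite mulN1r.
Qed.

Lemma seg_int_cst a b c : a <= b -> seg_int a b (fun=> c) = c * (b - a).
Proof.
move=> ab; rewrite /seg_int Rintegral_cst//= lebesgue_measure_itv/= lte_fin.
by case: ltP => // ba; rewrite (@le_anti _ _ a b) ?ab// subrr.
Qed.

Lemma eq_seg_int a b f g : (forall t, a <= t <= b -> f t = g t) ->
  seg_int a b f = seg_int a b g.
Proof.
by move=> fg; apply: eq_Rintegral => t; rewrite inE /= in_itv /= => /fg.
Qed.

Lemma le_seg_int a b f g : seg_cont a b f -> seg_cont a b g ->
  (forall t, a <= t <= b -> f t <= g t) -> seg_int a b f <= seg_int a b g.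
Proof.
move=> cf cg fg; apply: le_Rintegral => //; try exact: seg_integrable.
Qed.

Lemma seg_int_bound a b f M : a <= b -> seg_cont a b f ->
  (forall t, a <= t <= b -> `|f t| <= M) -> `|seg_int a b f| <= M * (b - a).
Proof.
move=> ab cf fM; rewrite ler_norml -mulNr -!seg_int_cst//.
apply/andP; split; apply: le_seg_int => //; try exact: seg_cont_cst;
  by move=> t /fM; rewrite ler_norml => /andP[].
Qed.

Lemma seg_int_derive a b F f : a < b ->
  (forall t, a <= t <= b -> is_derive t 1 F (f t)) -> seg_cont a b f ->
  seg_int a b f = F b - F a.
Proof.
move=> ab dF cf.
have cF t : a <= t <= b -> {for t, continuous F}.
  move=> /dF Ft; apply/differentiable_continuous/derivable1_diffP.
  exact: ex_derive.
rewrite /seg_int /Rintegral (@continuous_FTC2 _ f F)//.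
- exact: seg_cont_within.
- split.
  + move=> t /itvP tab; have tab' : a <= t <= b by rewrite !tab.
    by have := dF _ tab' => ?; exact: ex_derive.
  + by apply: cvg_at_right_filter; apply: cF; rewrite lexx ltW.
  + by apply: cvg_at_left_filter; apply: cF; rewrite lexx ltW.
- move=> t /itvP tab; have tab' : a <= t <= b by rewrite !tab.
  by rewrite derive1E; have := dF _ tab' => ?; exact: derive_val.
Qed.

(** The mean value theorem, applied on either side of 0, turns the increment into [df x * h]. The
    bound is uniform in whatever parameter [f] carries, as differentiation under the integral and
    total differentiability both require. *)
Lemma derive_increment_bound f (df : R -> R) c e h :
  (forall s : R, `|s| <= `|h| -> is_derive s 1 f (df s)) ->
  (forall s, `|s| <= `|h| -> `|df s - c| <= e) ->
  `|f h - f 0 - c * h| <= e * `|h|.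
Proof.
move=> dfE le.
have cf s : `|s| <= `|h| -> {for s, continuous f}.
  move=> /dfE Ft; apply/differentiable_continuous/derivable1_diffP.
  exact: ex_derive.
suff [x xh ->] : exists2 x, `|x| <= `|h| & f h - f 0 = df x * h.
  by rewrite -mulrBl normrM ler_wpM2r// le.
case: (leP 0 h) => h0.
  have [||x] := @MVT_segment _ f df _ _ h0.
  - move=> s; rewrite in_itv /= => /andP[s0 sh]; apply: dfE.
    by rewrite !ger0_norm// ltW.
  - apply: seg_cont_within => s /andP[s0 sh]; apply: cf.
    by rewrite !ger0_norm.
  - by rewrite subr0 in_itv => /andP[x0 xh] ->; exists x => //; rewrite !ger0_norm.
have [||x] := @MVT_segment _ f df _ _ (ltW h0).
- move=> s; rewrite in_itv /= => /andP[s0 sh]; apply: dfE.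
  by rewrite !ler0_norm ?lerN2// ltW.
- apply: seg_cont_within => s /andP[s0 sh]; apply: cf.
  by rewrite !ler0_norm ?lerN2// ltW.
- rewrite in_itv sub0r => /andP[x0 xh] E; exists x.
    by rewrite !ler0_norm ?lerN2// ltW.
  by rewrite -[LHS]opprB E mulrN opprK.
Qed.

(** Tube lemma: compactness of the segment makes one neighbourhood of [x0] serve all [t]. *)
Lemma near_segment (T : topologicalType) a b (P : R -> T -> Prop) (x0 : T) :
  (forall t, a <= t <= b -> \forall q \near (t, x0), P q.1 q.2) ->
  \forall x \near x0, forall t, a <= t <= b -> P t x.
Proof.
move=> H.
have /compact_near_coveringP/(_ T (nbhs x0) (fun x t => P t x)) C :=
  @segment_compact R a b.
apply: filterS (C _ _).
  by move=> x Hx t tab; apply: Hx; rewrite /= in_itv.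
by move=> t /=; rewrite in_itv /= => /H.
Qed.

(** Near [(t, x0)] both [K s x] and [K s x0] lie within [e / 2] of [K t x0]; compactness then gives
    uniformity in [t]. *)
Lemma seg_int_param_near (T : topologicalType) a b (K : R -> T -> R) (x0 : T) e :
  0 < e ->
  (forall t, a <= t <= b -> {for (t, x0), continuous (fun q => K q.1 q.2)}) ->
  \forall x \near x0, forall t, a <= t <= b -> `|K t x - K t x0| <= e.
Proof.
move=> e0 cK; apply: near_segment => t tab.
have /cvgrPdist_lt/(_ (e / 2)) := cK _ tab; rewrite divr_gt0// => /(_ isT) H1.
have [[A B] [/= nA nB] AB] := H1.
exists (A, B) => // -[s x] /= [As Bx].
have /= := AB (s, x) (conj As Bx); have /= := AB (s, x0) (conj As (nbhs_singleton nB)).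
by rewrite !ltr_norml ler_norml => /andP[? ?] /andP[? ?]; lra.
Qed.

Lemma seg_int_param_continuous (T : topologicalType) a b (K : R -> T -> R) x0 :
  a <= b -> (\forall x \near x0, seg_cont a b (K ^~ x)) ->
  (forall t, a <= t <= b -> {for (t, x0), continuous (fun q => K q.1 q.2)}) ->
  {for x0, continuous (fun x => seg_int a b (K ^~ x))}.
Proof.
move=> ab cKx cK; apply/cvgrPdist_le => /= e e0.
(* The summand 1 keeps the denominator positive when [a = b]. *)
have e'0 : 0 < e / (b - a + 1) by rewrite divr_gt0// ltr_wpDl// subr_ge0.
have K0 := nbhs_singleton cKx.
near=> x.
have cx : seg_cont a b (K ^~ x) by near: x.
rewrite -(seg_intN cx) -seg_intD//; last exact: seg_contN.
apply: (@le_trans _ _ (e / (b - a + 1) * (b - a))).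
  apply: seg_int_bound => //; first by apply: seg_contD => //; exact: seg_contN.
  move=> t tab; rewrite distrC; move: t tab; near: x.
  exact: seg_int_param_near.
rewrite mulrAC ler_pdivrMr ?ltr_wpDl ?subr_ge0// ler_wpM2l ?(ltW e0)//; lra.
Unshelve. all: by end_near. Qed.

(** Differentiation under the integral sign: by [derive_increment_bound] the error of the
    first-order expansion of [K t] is at most a small multiple of [|h|], uniformly in [t], and this
    bound is integrated. *)
Lemma seg_int_param_derive a b (K dK : R -> R -> R) : a <= b ->
  (\forall s \near (0 : R), forall t, a <= t <= b -> is_derive (s : R) 1 (K t) (dK t s)) ->
  (\forall s \near (0 : R), seg_cont a b (K ^~ s)) ->
  (forall t, a <= t <= b -> {for (t, 0), continuous (fun q => dK q.1 q.2)}) ->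
  is_derive (0 : R) 1 (fun s => seg_int a b (K ^~ s)) (seg_int a b (dK ^~ 0)).
Proof.
move=> ab dKE cK cdK.
have cdK0 : seg_cont a b (dK ^~ 0).
  move=> t tab; apply: (@continuous_comp _ _ _ (fun t => (t, 0)) (fun q => dK q.1 q.2)).
    by apply: pair_continuous; [exact: cvg_id|exact: cvg_cst].
  exact: cdK.
have K0 := nbhs_singleton cK.
suff H : (fun h => h^-1 *: (((fun s => seg_int a b (K ^~ s)) \o shift 0) (h *: 1)
    - seg_int a b (K ^~ 0))) @ 0^' --> seg_int a b (dK ^~ 0).
  by split; [apply/cvg_ex; eexists; exact: H|exact: cvg_lim H].
apply/cvgrPdist_le => /= e e0.
have e'0 : 0 < e / (b - a + 1) by rewrite divr_gt0// ltr_wpDl// subr_ge0.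
have [d /= d0 Hd] : exists2 d : R, 0 < d & forall s, `|s| < d ->
   [/\ forall t, a <= t <= b -> is_derive (s : R) 1 (K t) (dK t s),
     seg_cont a b (K ^~ s) &
     forall t, a <= t <= b -> `|dK t s - dK t 0| <= e / (b - a + 1)].
  have : \forall s \near (0 : R), [/\ forall t, a <= t <= b -> is_derive (s : R) 1 (K t) (dK t s),
     seg_cont a b (K ^~ s) &
     forall t, a <= t <= b -> `|dK t s - dK t 0| <= e / (b - a + 1)].
    near=> s; split; near: s => //.
    by apply: (@seg_int_param_near R a b dK 0).
  case=> d /= d0 H; exists d => // s sd; apply: H.
  by rewrite /ball /= sub0r normrN.
near=> h; rewrite /= addr0 [h *: 1]mulr1.
have h0 : h != 0 by near: h; exact: nbhs_dnbhs_neq.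
have hd : `|h| < d.
  near: h; apply: dnbhs0_lt => //.
have [dh ch eh] := Hd _ hd.
rewrite [h^-1 *: _]/(h^-1 * _) -[X in `|X - _|](mulKf h0) -mulrBr normrM normfV.
rewrite mulrC ler_pdivrMr ?normr_gt0//.
have -> : h * seg_int a b (dK^~ 0) - (seg_int a b (K^~ h) - seg_int a b (K^~ 0)) =
  - seg_int a b (fun t => K t h + (- K t 0) + (- (h * dK t 0))).
  have c1 : seg_cont a b (fun t => - K t 0) by exact: seg_contN.
  have c2 : seg_cont a b (fun t => h * dK t 0).
    by apply: seg_contM => //; exact: seg_cont_cst.
  have c3 : seg_cont a b (fun t => - (h * dK t 0)) by exact: seg_contN.
  rewrite (@seg_intD a b (fun t => K t h + - K t 0))//; last exact: seg_contD.
  by rewrite seg_intD// !seg_intN// seg_intZ//; lra.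
rewrite normrN.
apply: (@le_trans _ _ (e / (b - a + 1) * `|h| * (b - a))).
  apply: seg_int_bound => //.
    apply: seg_contD; first by apply: seg_contD => //; exact: seg_contN.
    by apply: seg_contN; apply: seg_contM => //; exact: seg_cont_cst.
  move=> t tab; rewrite [h * _]mulrC; apply: (@derive_increment_bound _ (dK t)).
    by move=> s sh; have [+ _ _] := Hd s (le_lt_trans sh hd); exact.
  by move=> s sh; have [_ _] := Hd s (le_lt_trans sh hd); exact.
rewrite -mulrA [`|h| * _]mulrC mulrA ler_wpM2r//.
rewrite mulrAC ler_pdivrMr ?ltr_wpDl ?subr_ge0// ler_wpM2l ?(ltW e0)//; lra.
Unshelve. all: by end_near. Qed.

End SegmentIntegral.

(** The two difference quotients are the same function of the increment. *)
Lemma is_derive_line {R : realType} (V W : normedModType R) (f : V -> W)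
    (p v : V) (s : R) d :
  is_derive (p + s *: v) v f d <-> is_derive s 1 (fun s : R => f (p + s *: v)) d.
Proof.
have E : (fun h : R => h^-1 *: ((f \o shift (p + s *: v)) (h *: v) - f (p + s *: v)))
    = (fun h : R => h^-1 *: (((fun s : R => f (p + s *: v)) \o shift s) (h *: 1) -
         f (p + s *: v))).
  apply/funext => h /=; congr (_ *: (f _ - _)).
  by rewrite [h *: 1]mulr1 scalerDl addrCA.
by split=> -[D1 D2]; split; move: D1 D2; rewrite /derivable /derive /= E.
Qed.

(** * Real differential calculus in the plane *)

Section Plane.
Context {R : realType}.
Local Notation plane := (R^o * R^o)%type.
Implicit Types (p z h : plane) (u v a b f : plane -> R).

Lemma plane_fst_continuous : continuous (fun p : plane => p.1 : R).
Proof. exact: (@fst_continuous R^o R^o). Qed.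

Lemma plane_snd_continuous : continuous (fun p : plane => p.2 : R).
Proof. exact: (@snd_continuous R^o R^o). Qed.

Lemma plane_derive_line1 f p (s : R) d :
  is_derive ((p.1 + s, p.2) : plane) (dir_x R) f d ->
  is_derive s 1 (fun s : R => f (p.1 + s, p.2)) d.
Proof.
have E (t : R) : ((p.1 + t, p.2) : plane) = p + t *: dir_x R.
  by case: p => x y; congr (_, _); rewrite /= ?[_ *: 1]mulr1 ?[_ *: 0]mulr0 ?addr0.
by rewrite E => /is_derive_line; under eq_fun do rewrite -E.
Qed.

Lemma plane_derive_line2 f p (s : R) d :
  is_derive ((p.1, p.2 + s) : plane) (dir_y R) f d ->
  is_derive s 1 (fun s : R => f (p.1, p.2 + s)) d.
Proof.
have E (t : R) : ((p.1, p.2 + t) : plane) = p + t *: dir_y R.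
  by case: p => x y; congr (_, _); rewrite /= ?[_ *: 1]mulr1 ?[_ *: 0]mulr0 ?addr0.
by rewrite E => /is_derive_line; under eq_fun do rewrite -E.
Qed.

Lemma plane_norm h : `|h| = Num.max `|h.1| `|h.2|.
Proof. by rewrite prod_normE. Qed.

(** The increment is split at the corner [(p.1, p.2 + h.2)] into a vertical and a horizontal one;
    each stays within [e / 2] times the norm of [h] of its linear part. *)
Lemma C1_is_diff f a b p :
  (\forall q \near p, is_derive q (dir_x R) f (a q)) ->
  (\forall q \near p, is_derive q (dir_y R) f (b q)) ->
  {for p, continuous a} -> {for p, continuous b} ->
  is_diff p f (fun h => a p * h.1 + b p * h.2).
Proof.
move=> fx fy ca cb.
pose d h : R := a p * h.1 + b p * h.2.
have lind : linear d.
  have E (A B k x1 x2 y1 y2 : R) : A * (k * x1 + y1) + B * (k * x2 + y2) =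
    k * (A * x1 + B * x2) + (A * y1 + B * y2) by ring.
  by move=> k x y; exact: E.
pose lM := GRing.isLinear.Build _ _ _ _ _ lind.
pose L : {linear plane -> R} := HB.pack d lM.
have Lc : continuous L.
  suff : continuous d by [].
  move=> q; apply: cvgD; apply: cvgM.
  - exact: cvg_cst.
  - exact: plane_fst_continuous.
  - exact: cvg_cst.
  - exact: plane_snd_continuous.
have Ho e0 : 0 < e0 ->
    \forall h \near (0 : plane), `|f (h + p) - (f p + d h)| <= e0 * `|h|.
  move=> /posnumP[e].
  have e2 : 0 < e%:num / 2 by [].
  have /cvgrPdist_lt/(_ _ e2) Ha := ca.
  have /cvgrPdist_lt/(_ _ e2) Hb := cb.
  have : \forall q \near p, [/\ is_derive q (dir_x R) f (a q), 
     is_derive q (dir_y R) f (b q), `|a p - a q| < e%:num / 2 & `|b p - b q| < e%:num / 2].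
    by near=> q; split; near: q.
  move=> /nbhs_ballP[r /= r0 Hr].
  have hr0 : \forall h \near (0 : plane), `|h| < r := nbhs0_lt r0.
  near=> h.
  have hr : `|h| < r by near: h.
  have h1 : `|h.1| <= `|h| by rewrite plane_norm le_max lexx.
  have h2 : `|h.2| <= `|h| by rewrite plane_norm le_max lexx orbT.
  have Hs (s t : R) : `|s| <= `|h| -> `|t| <= `|h| ->
     [/\ is_derive ((p.1 + s, p.2 + t) : plane) (dir_x R) f (a (p.1 + s, p.2 + t)), 
     is_derive ((p.1 + s, p.2 + t) : plane) (dir_y R) f (b (p.1 + s, p.2 + t)), 
      `|a p - a (p.1 + s, p.2 + t)| < e%:num / 2 & `|b p - b (p.1 + s, p.2 + t)| < e%:num / 2].
    move=> sh th; apply: Hr; split; rewrite /= /ball /= opprD addNKr normrN.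
      exact: le_lt_trans hr. exact: le_lt_trans hr.
  have B1 : `|f (p.1 + h.1, p.2 + h.2) - f (p.1 + 0, p.2 + h.2) - a p * h.1| <= e%:num / 2 * `|h.1|.
    apply: (@derive_increment_bound _ (fun s => f (p.1 + s, p.2 + h.2))
      (fun s => a (p.1 + s, p.2 + h.2))).
      move=> s sh; apply: (@plane_derive_line1 _ (p.1, p.2 + h.2)).
      by have [] := Hs s h.2 (le_trans sh h1) h2.
    move=> s sh; have [_ _ + _] := Hs s h.2 (le_trans sh h1) h2.
    by rewrite distrC => /ltW.
  have B2 : `|f (p.1, p.2 + h.2) - f (p.1, p.2 + 0) - b p * h.2| <= e%:num / 2 * `|h.2|.
    have Hs0 s := @Hs 0 s. rewrite addr0 normr0 in Hs0.
    apply: (@derive_increment_bound _ (fun s => f (p.1, p.2 + s)) (fun s => b (p.1, p.2 + s))).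
      move=> s sh; apply: (@plane_derive_line2 _ p).
      by have [] := Hs0 s (normr_ge0 _) (le_trans sh h2).
    move=> s sh; have [_ _ _] := Hs0 s (normr_ge0 _) (le_trans sh h2).
    by rewrite distrC => /ltW.
  have -> : f (h + p) - (f p + d h) =
     (f (p.1 + h.1, p.2 + h.2) - f (p.1 + 0, p.2 + h.2) - a p * h.1) +
     (f (p.1, p.2 + h.2) - f (p.1, p.2 + 0) - b p * h.2).
    rewrite !addr0 /= /d.
    have -> : h + p = (p.1 + h.1, p.2 + h.2) by rewrite addrC.
    have -> : (p.1, p.2) = p by case: (p).
    ring.
  apply: le_trans (ler_normD _ _) _.
  have := ler_wpM2l (ltW e2) h1.
  have := ler_wpM2l (ltW e2) h2.
  by lra.
have dE : 'd f p = L :> (plane -> R) by apply: diff_unique => //; apply/eqaddoP.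
split; last exact: dE.
by apply/diff_locallyP; rewrite dE; split => //; apply/eqaddoP.
Unshelve. all: by end_near. Qed.

Lemma is_diff_curve f d (x y : R -> R) (t dx dy : R) :
  is_diff ((x t, y t) : plane) f d -> is_derive t 1 x dx -> is_derive t 1 y dy ->
  is_derive t 1 (fun s => f (x s, y s)) (d (dx, dy)).
Proof.
move=> fd xd yd.
have [xd' yd'] : differentiable x t /\ differentiable y t.
  by split; apply/derivable1_diffP; apply: ex_derive.
have [fd' fdE] : differentiable f ((x t, y t) : plane) /\
  'd f ((x t, y t) : plane) = d :> (plane -> R) by case: fd.
pose g : R -> plane := fun s => (x s, y s).
have gd : differentiable g t by apply: (@differentiable_pair _ _ R^o R^o).
have fgd : differentiable (f \o g) t by exact: differentiable_comp.
split; first by apply/derivable1_diffP.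
rewrite [LHS](_ : _ = 'D_1 (f \o g) t)// deriveE// diff_comp//= fdE.
rewrite /g (@diff_pair _ _ R^o R^o)//.
by rewrite -!deriveE// !derive_val.
Qed.

End Plane.

(** * Complex differentiable functions of the plane *)

Section Holomorphic.
Context {R : realType}.
Local Notation plane := (R^o * R^o)%type.
Local Notation dx := (dir_x R).
Local Notation dy := (dir_y R).
Implicit Types (D : set plane) (p z w e : plane) (u v a b f g : plane -> R).

(* The complex function u + i v is continuously differentiable on D in the complex
   sense, with derivative a + i b. *)
Definition hol D u v a b := forall p, D p ->
  [/\ is_derive p dx u (a p), is_derive p dy u (- b p),
      is_derive p dx v (b p), is_derive p dy v (a p) &
      {for p, continuous a} /\ {for p, continuous b}].

Lemma hol_sub D D' u v a b : D' `<=` D -> hol D u v a b -> hol D' u v a b.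
Proof. by move=> D'D H p /D'D/H. Qed.

Lemma hol_is_diff D u v a b p : open D -> hol D u v a b -> D p ->
  is_diff p u (fun h => a p * h.1 + - b p * h.2) /\
  is_diff p v (fun h => b p * h.1 + a p * h.2).
Proof.
move=> oD H Dp; have nD : \forall q \near p, D q by exact: open_nbhs_nbhs.
have [_ _ _ _ [ca cb]] := H _ Dp.
split.
  apply: (@C1_is_diff _ u a (fun p => - b p)) => //.
  - by apply: filterS nD => q /H[].
  - by apply: filterS nD => q /H[].
  - exact: continuousN.
by apply: (@C1_is_diff _ v b a) => //; apply: filterS nD => q /H[].
Qed.

Lemma is_diff_continuous f d p : is_diff p f d -> {for p, continuous f}.
Proof. by case=> fd _; exact: differentiable_continuous. Qed.

Lemma hol_continuous D u v a b p : open D -> hol D u v a b -> D p ->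
  {for p, continuous u} /\ {for p, continuous v}.
Proof.
by move=> oD H /(hol_is_diff oD H)[]; split; apply: is_diff_continuous; eassumption.
Qed.

(** Chain rule F' gamma' in real and imaginary parts. It needs total differentiability of [u] and
    [v], which is why [hol] includes continuity of the derivative. *)
Lemma hol_curve D u v a b (x y : R -> R) (t x' y' : R) : open D ->
  hol D u v a b -> D (x t, y t) -> is_derive t 1 x x' -> is_derive t 1 y y' ->
  is_derive t 1 (fun s => u (x s, y s)) (a (x t, y t) * x' - b (x t, y t) * y') /\
  is_derive t 1 (fun s => v (x s, y s)) (b (x t, y t) * x' + a (x t, y t) * y').
Proof.
move=> oD H Dt xd yd; have [ud vd] := hol_is_diff oD H Dt; split.
  by rewrite -mulNr; exact: (is_diff_curve ud xd yd).
exact: (is_diff_curve vd xd yd).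
Qed.

Lemma plane_derive_line f p d :
  (is_derive p dx f d <-> is_derive (0 : R) 1 (fun s => f (p.1 + s, p.2)) d) /\
  (is_derive p dy f d <-> is_derive (0 : R) 1 (fun s => f (p.1, p.2 + s)) d).
Proof.
have E1 (s : R) : (p.1 + s, p.2) = p + s *: dx.
  by case: (p) => x y; congr (_, _); rewrite /= ?[_ *: 1]mulr1 ?[_ *: 0]mulr0 ?addr0.
have E2 (s : R) : (p.1, p.2 + s) = p + s *: dy.
  by case: (p) => x y; congr (_, _); rewrite /= ?[_ *: 1]mulr1 ?[_ *: 0]mulr0 ?addr0.
split.
  under eq_fun do rewrite E1.
  by rewrite -is_derive_line scale0r addr0.
under eq_fun do rewrite E2.
by rewrite -is_derive_line scale0r addr0.
Qed.

(* s = -1 is the reflection g(conj z) followed by conjugation. *)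
Lemma hol_affine D D' u v a b (k s : R) w : open D -> s = 1 \/ s = -1 ->
  hol D u v a b -> (forall z, D' z -> D (w.1 + k * z.1, w.2 + s * k * z.2)) ->
  hol D' (fun z => u (w.1 + k * z.1, w.2 + s * k * z.2))
         (fun z => s * v (w.1 + k * z.1, w.2 + s * k * z.2))
         (fun z => k * a (w.1 + k * z.1, w.2 + s * k * z.2))
         (fun z => s * k * b (w.1 + k * z.1, w.2 + s * k * z.2)).
Proof.
move=> oD s1 H DD z /DD Dz.
(* The two conjugations cancel in the derivative of the imaginary part along [dir_y]. *)
have ss : s * s = 1 by case: s1 => ->; ring.
have lin (c d e : R) : is_derive (0 : R) 1 (fun t => c + d * (e + t)) d.
  have -> : (fun t => c + d * (e + t)) = (cst (c + d * e) + d \*: id : R -> R).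
    by apply/funext => t; rewrite mulrDr addrA.
  by apply: is_derive_eq; rewrite add0r [LHS]mulr1.
have cst0 (c : R) : is_derive (0 : R) 1 (fun=> c) 0 by exact: is_derive_cst.
have D1 : D (w.1 + k * (z.1 + 0), w.2 + s * k * z.2) by rewrite addr0.
have D2 : D (w.1 + k * z.1, w.2 + s * k * (z.2 + 0)) by rewrite addr0.
have [u1 v1] := @hol_curve _ _ _ _ _ (fun t => w.1 + k * (z.1 + t))
  (fun=> w.2 + s * k * z.2) 0 _ _ oD H D1 (lin w.1 k z.1) (cst0 _).
have [u2 v2] := @hol_curve _ _ _ _ _ (fun=> w.1 + k * z.1)
  (fun t => w.2 + s * k * (z.2 + t)) 0 _ _ oD H D2 (cst0 _) (lin w.2 (s * k) z.2).
have mulc (f : R -> R) d : is_derive (0 : R) 1 f d ->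
    is_derive (0 : R) 1 (fun t => s * f t) (s * d).
  by move=> fd; apply: (@is_deriveZ _ _ _ f s).
have cm : {for z, continuous (fun z : plane => (w.1 + k * z.1, w.2 + s * k * z.2) : plane)}.
  apply: pair_continuous; apply: cvgD; try exact: cvg_cst.
    by apply: cvgM; [exact: cvg_cst|exact: plane_fst_continuous].
  by apply: cvgM; [exact: cvg_cst|exact: plane_snd_continuous].
have [_ _ _ _ [ca cb]] := H _ Dz.
split.
- apply/(plane_derive_line _ _ _).1; apply: is_derive_eq u1 _.
  by rewrite addr0; ring.
- apply/(plane_derive_line _ _ _).2; apply: is_derive_eq u2 _.
  by rewrite addr0; ring.
- apply/(plane_derive_line _ _ _).1; apply: is_derive_eq (mulc _ _ v1) _.
  by rewrite addr0; ring.
- apply/(plane_derive_line _ _ _).2; apply: is_derive_eq (mulc _ _ v2) _.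
  by rewrite addr0 -[RHS]mul1r -ss; ring.
- split; apply: cvgM; try exact: cvg_cst.
    exact: (@continuous_comp _ _ _ _ a z cm ca).
  exact: (@continuous_comp _ _ _ _ b z cm cb).
Qed.

Lemma scaleRE (k x : R) : k *: x = k * x. Proof. by []. Qed.

Lemma hol_cst D (c d : R) : hol D (fun=> c) (fun=> d) (fun=> 0) (fun=> 0).
Proof.
move=> p _; split; try exact: is_derive_cst; last by split; exact: cst_continuous.
by rewrite oppr0; exact: is_derive_cst.
Qed.

Lemma hol_add D u1 v1 a1 b1 u2 v2 a2 b2 :
  hol D u1 v1 a1 b1 -> hol D u2 v2 a2 b2 ->
  hol D (fun z => u1 z + u2 z) (fun z => v1 z + v2 z)
        (fun z => a1 z + a2 z) (fun z => b1 z + b2 z).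
Proof.
move=> H1 H2 p Dp.
have [? ? ? ? [? ?]] := H1 _ Dp; have [? ? ? ? [? ?]] := H2 _ Dp.
split.
- exact: (@is_deriveD _ _ _ u1 u2).
- by rewrite opprD; exact: (@is_deriveD _ _ _ u1 u2).
- exact: (@is_deriveD _ _ _ v1 v2).
- exact: (@is_deriveD _ _ _ v1 v2).
- by split; apply: cvgD.
Qed.

Let derM f g p e d d' : is_derive p e f d -> is_derive p e g d' ->
  is_derive p e (fun z => f z * g z) (f p * d' + g p * d).
Proof. by move=> fd gd; exact: (is_deriveM fd gd). Qed.

Let derD f g p e d d' : is_derive p e f d -> is_derive p e g d' ->
  is_derive p e (fun z => f z + g z) (d + d').
Proof. by move=> fd gd; exact: (is_deriveD fd gd). Qed.

Let derB f g p e d d' : is_derive p e f d -> is_derive p e g d' ->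
  is_derive p e (fun z => f z - g z) (d - d').
Proof. by move=> fd gd; exact: (is_deriveB fd gd). Qed.

Lemma hol_mul D u1 v1 a1 b1 u2 v2 a2 b2 : open D ->
  hol D u1 v1 a1 b1 -> hol D u2 v2 a2 b2 ->
  hol D (fun z => u1 z * u2 z - v1 z * v2 z) (fun z => u1 z * v2 z + v1 z * u2 z)
    (fun z => a1 z * u2 z + u1 z * a2 z - (b1 z * v2 z + v1 z * b2 z))
    (fun z => a1 z * v2 z + u1 z * b2 z + (b1 z * u2 z + v1 z * a2 z)).
Proof.
move=> oD H1 H2 p Dp.
have [cu1 cv1] := hol_continuous oD H1 Dp.
have [cu2 cv2] := hol_continuous oD H2 Dp.
have [u1x u1y v1x v1y [ca1 cb1]] := H1 _ Dp.
have [u2x u2y v2x v2y [ca2 cb2]] := H2 _ Dp.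
split.
- by apply: is_derive_eq (derB (derM u1x u2x) (derM v1x v2x)) _; ring.
- by apply: is_derive_eq (derB (derM u1y u2y) (derM v1y v2y)) _; ring.
- by apply: is_derive_eq (derD (derM u1x v2x) (derM v1x u2x)) _; ring.
- by apply: is_derive_eq (derD (derM u1y v2y) (derM v1y u2y)) _; ring.
- split; [apply: cvgB|apply: cvgD]; apply: cvgD; apply: cvgM => //.
Qed.

Lemma is_derive_inv f p e d : f p != 0 -> is_derive p e f d ->
  is_derive p e (fun z => (f z)^-1) (- (f p) ^- 2 * d).
Proof.
move=> f0 [fd fE]; split; first exact: derivableV.
by rewrite [LHS](@deriveV _ _ f)// fE.
Qed.

Lemma hol_inv D u v a b : open D -> hol D u v a b ->
  (forall z, D z -> u z ^+ 2 + v z ^+ 2 != 0) ->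
  exists A B, hol D (fun z => u z / (u z ^+ 2 + v z ^+ 2))
                (fun z => - v z / (u z ^+ 2 + v z ^+ 2)) A B.
Proof.
move=> oD H n0.
pose n z := u z ^+ 2 + v z ^+ 2.
(* Real and imaginary parts of - F' / F^2, rewritten as - F' conj(F)^2 / |F|^4. *)
exists (fun z => - (a z * (u z ^+ 2 - v z ^+ 2) + 2 * b z * (u z * v z)) / n z ^+ 2).
exists (fun z => - (b z * (u z ^+ 2 - v z ^+ 2) - 2 * a z * (u z * v z)) / n z ^+ 2).
move=> p Dp.
have [cu cv] := hol_continuous oD H Dp.
have [ux uy vx vy [ca cb]] := H _ Dp.
have np := n0 _ Dp; rewrite -/(n p) in np.
have nx := is_derive_inv np (derD (derM ux ux) (derM vx vx)).
have ny := is_derive_inv np (derD (derM uy uy) (derM vy vy)).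
have der0 e : is_derive p e (fun=> 0 : R) 0 by exact: is_derive_cst.
have cn : {for p, continuous (fun z => n z ^+ 2)}.
  by apply: cvgM; apply: cvgD; apply: cvgM.
have n2 : n p ^+ 2 != 0 by rewrite expf_neq0.
have -> : (fun z => - v z / (u z ^+ 2 + v z ^+ 2)) =
    (fun z => (0 - v z) * (u z ^+ 2 + v z ^+ 2)^-1).
  by apply/funext => z; rewrite sub0r.
rewrite /n in np *.
split.
- by apply: is_derive_eq (derM ux nx) _; rewrite /n; field.
- by apply: is_derive_eq (derM uy ny) _; rewrite /n; field.
- by apply: is_derive_eq (derM (derB (der0 _) vx) nx) _; rewrite /n; field.
- by apply: is_derive_eq (derM (derB (der0 _) vy) ny) _; rewrite /n; field.
- split; apply: cvgM; try exact: cvgV.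
    apply: cvgN; apply: cvgD; apply: cvgM => //.
    + by apply: cvgB; apply: cvgM.
    + by apply: cvgM => //; exact: cvg_cst.
    + by apply: cvgM.
  apply: cvgN; apply: cvgB; apply: cvgM => //.
  + by apply: cvgB; apply: cvgM.
  + by apply: cvgM => //; exact: cvg_cst.
  + by apply: cvgM.
Qed.

End Holomorphic.

(** * The mean value property *)

Section CauchyTheory.
Context {R : realType}.
Local Notation plane := (R^o * R^o)%type.
Implicit Types (D : set plane) (p z w e : plane) (u v a b f g : plane -> R).
Implicit Types (t r s : R).

Lemma seg_cont_section (T : topologicalType) (K : R -> T -> R) c d x :
  (forall t, c <= t <= d -> {for (t, x), continuous (fun q => K q.1 q.2)}) ->
  seg_cont c d (K ^~ x).
Proof.
move=> cK t tcd.
have h : {for t, continuous (fun t => (t, x))}.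
  by apply: pair_continuous; [exact: cvg_id|exact: cvg_cst].
exact: (comp_continuous h (cK _ tcd)).
Qed.

(** Differentiation under the integral along the two coordinate lines preserves the Cauchy-Riemann
    equations. It serves for means over circles and for means over segments. *)
Lemma hol_seg_int D c d (U V A B : R -> plane -> R) : c <= d -> open D ->
  (forall t, c <= t <= d -> hol D (U t) (V t) (A t) (B t)) ->
  (forall z, D z -> seg_cont c d (U ^~ z) /\ seg_cont c d (V ^~ z)) ->
  (forall t z, c <= t <= d -> D z -> {for (t, z), continuous (fun q => A q.1 q.2)} /\
     {for (t, z), continuous (fun q => B q.1 q.2)}) ->
  hol D (fun z => seg_int c d (U ^~ z)) (fun z => seg_int c d (V ^~ z))
        (fun z => seg_int c d (A ^~ z)) (fun z => seg_int c d (B ^~ z)).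
Proof.
move=> cd oD H UVc ABc z Dz.
have nD : nbhs z D by exact: open_nbhs_nbhs.
(* [m] stands for either coordinate line through [z], so that one argument covers all four partial
   derivatives. *)
have line (m : R -> plane) (F F' : R -> plane -> R) : m 0 = z ->
    {for 0, continuous m} ->
    (forall s t, D (m s) -> c <= t <= d ->
      is_derive s 1 (fun s => F t (m s)) (F' t (m s))) ->
    (forall z, D z -> seg_cont c d (F ^~ z)) ->
    (forall t, c <= t <= d -> {for (t, z), continuous (fun q => F' q.1 q.2)}) ->
    is_derive (0 : R) 1 (fun s => seg_int c d (F ^~ (m s))) (seg_int c d (F' ^~ z)).
  move=> m0 cm dF cF cF'.
  have nm : \forall s \near (0 : R), D (m s) by apply: cm; rewrite m0.
  rewrite -m0.
  apply: (@seg_int_param_derive _ c d (fun t s => F t (m s)) (fun t s => F' t (m s))) => //.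
  - by apply: filterS nm => s Ds t tcd; exact: dF.
  - by apply: filterS nm => s Ds; exact: cF.
  - move=> t tcd.
    have h0 : {for (t, 0 : R), continuous (fun q : R * R => m q.2)}.
      exact: (@comp_continuous _ _ _ (fun q : R * R => q.2) m (t, 0)
        (@snd_continuous _ _ _) cm).
    have h1 := pair_continuous (@fst_continuous R R (t, 0)) h0.
    have h2 := cF' _ tcd; rewrite -m0 in h2.
    exact: (comp_continuous h1 h2).
pose m1 s : plane := (z.1 + s, z.2).
pose m2 s : plane := (z.1, z.2 + s).
have m10 : m1 0 = z by rewrite /m1 addr0; case: (z).
have m20 : m2 0 = z by rewrite /m2 addr0; case: (z).
have m1c : {for 0, continuous m1}.
  apply: pair_continuous; last exact: cvg_cst.
  by apply: cvgD; [exact: cvg_cst|exact: cvg_id].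
have m2c : {for 0, continuous m2}.
  apply: pair_continuous; first exact: cvg_cst.
  by apply: cvgD; [exact: cvg_cst|exact: cvg_id].
have Ac t : c <= t <= d -> {for (t, z), continuous (fun q => A q.1 q.2)}.
  by move=> tcd; have [] := ABc t z tcd Dz.
have Bc t : c <= t <= d -> {for (t, z), continuous (fun q => B q.1 q.2)}.
  by move=> tcd; have [] := ABc t z tcd Dz.
split.
- apply/(plane_derive_line _ _ _).1; apply: (line m1) => //.
    by move=> s t /H {}H /H[] Hd _ _ _ _; apply: (@plane_derive_line1 _ (U t) z).
  by move=> w /UVc[].
- apply/(plane_derive_line _ _ _).2; rewrite -seg_intN; last exact: seg_cont_section.
  apply: (line m2 U (fun t z => - B t z)) => //.
  + by move=> s t /H {}H /H[] _ Hd _ _ _; apply: (@plane_derive_line2 _ (U t) z).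
  + by move=> w /UVc[].
  + by move=> t /Bc Bt; exact: cvgN.
- apply/(plane_derive_line _ _ _).1; apply: (line m1) => //.
    by move=> s t /H {}H /H[] _ _ Hd _ _; apply: (@plane_derive_line1 _ (V t) z).
  by move=> w /UVc[].
- apply/(plane_derive_line _ _ _).2; apply: (line m2) => //.
    by move=> s t /H {}H /H[] _ _ _ Hd _; apply: (@plane_derive_line2 _ (V t) z).
  by move=> w /UVc[].
- split; apply: seg_int_param_continuous => //.
    by apply: filterS nD => w Dw; apply: seg_cont_section => t tcd; have [] := ABc t w tcd Dw.
  by apply: filterS nD => w Dw; apply: seg_cont_section => t tcd; have [] := ABc t w tcd Dw.
Qed.

(** The point z + r e^{it}. The radius may be zero or negative, so that derivatives in [r] at 0 are
    two-sided. *)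
Definition circle z r t : plane := (z.1 + r * cos t, z.2 + r * sin t).

Lemma circle_continuous (T : topologicalType) (z : T -> plane) (r t : T -> R) x :
  {for x, continuous z} -> {for x, continuous r} -> {for x, continuous t} ->
  {for x, continuous (fun y => circle (z y) (r y) (t y))}.
Proof.
move=> cz cr ct.
have c1 : {for x, continuous (fun y => (z y).1 : R)}.
  have H := @comp_continuous T plane R z (fun p => p.1 : R) x cz.
  by apply: H; exact: plane_fst_continuous.
have c2 : {for x, continuous (fun y => (z y).2 : R)}.
  have H := @comp_continuous T plane R z (fun p => p.2 : R) x cz.
  by apply: H; exact: plane_snd_continuous.
have c3 : {for x, continuous (fun y => (z y).1 + r y * cos (t y))}.
  exact: (real_continuousD c1 (real_continuousM cr (real_continuous_cos ct))).
have c4 : {for x, continuous (fun y => (z y).2 + r y * sin (t y))}.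
  exact: (real_continuousD c2 (real_continuousM cr (real_continuous_sin ct))).
exact: pair_continuous.
Qed.

Lemma circle_comp_continuous (T : topologicalType) f (z : T -> plane) (r t : T -> R) x :
  {for x, continuous z} -> {for x, continuous r} -> {for x, continuous t} ->
  {for circle (z x) (r x) (t x), continuous f} ->
  {for x, continuous (fun y => f (circle (z y) (r y) (t y)))}.
Proof.
move=> cz cr ct cf.
exact: (comp_continuous (circle_continuous cz cr ct) cf).
Qed.

(** The radial derivative is F' e^{it}; the angular one below is i r e^{it} F'. *)
Lemma hol_circle_radial D u v a b z r t : open D -> hol D u v a b ->
  D (circle z r t) ->
  is_derive r 1 (fun r => u (circle z r t))
    (a (circle z r t) * cos t - b (circle z r t) * sin t) /\
  is_derive r 1 (fun r => v (circle z r t))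
    (b (circle z r t) * cos t + a (circle z r t) * sin t).
Proof.
move=> oD H Dc.
apply: (@hol_curve _ D _ _ _ _ (fun r => z.1 + r * cos t) (fun r => z.2 + r * sin t) r _ _ oD H Dc).
  have -> : (fun r => z.1 + r * cos t) = (cst (z.1 : R) + cos t \*: id : R -> R).
    by apply/funext => s; rewrite mulrC.
  by apply: is_derive_eq; rewrite add0r [LHS]mulr1.
have -> : (fun r => z.2 + r * sin t) = (cst (z.2 : R) + sin t \*: id : R -> R).
  by apply/funext => s; rewrite mulrC.
by apply: is_derive_eq; rewrite add0r [LHS]mulr1.
Qed.

Lemma hol_circle_angular D u v a b z r t : open D -> hol D u v a b ->
  D (circle z r t) ->
  is_derive t 1 (fun t => u (circle z r t))
    (a (circle z r t) * (r * - sin t) - b (circle z r t) * (r * cos t)) /\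
  is_derive t 1 (fun t => v (circle z r t))
    (b (circle z r t) * (r * - sin t) + a (circle z r t) * (r * cos t)).
Proof.
move=> oD H Dc.
apply: (@hol_curve _ D _ _ _ _ (fun t => z.1 + r * cos t) (fun t => z.2 + r * sin t) t _ _ oD H Dc).
  have -> : (fun t => z.1 + r * cos t) = (cst (z.1 : R) + r \*: (@cos R)) by [].
  by apply: is_derive_eq; rewrite add0r.
have -> : (fun t => z.2 + r * sin t) = (cst (z.2 : R) + r \*: (@sin R)) by [].
by apply: is_derive_eq; rewrite add0r.
Qed.

Local Notation tau := ((pi : R) *+ 2).
Local Notation cint := (seg_int 0 tau).

Lemma tau_gt0 : 0 < tau. Proof. by rewrite mulrn_wgt0// pi_gt0. Qed.
#[local] Hint Resolve tau_gt0 : core.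

Lemma circle_period z r : circle z r tau = circle z r 0.
Proof. by rewrite /circle cos2pi sin2pi cos0 sin0. Qed.

Lemma seg_int_derive_at (K dK : R -> R -> R) r :
  (forall s t, `|s| < r -> is_derive s 1 (K t) (dK t s)) ->
  (forall s t, `|s| < r -> {for t, continuous (K ^~ s)}) ->
  (forall s t, `|s| < r -> {for (t, s), continuous (fun q => dK q.1 q.2)}) ->
  forall s, `|s| < r ->
    is_derive s 1 (fun s => cint (K ^~ s)) (cint (dK ^~ s)).
Proof.
move=> H1 H2 H3 s sr.
have shift0 (f : R -> R) (d : R) : is_derive (0 : R) 1 (fun h => f (s + h)) d -> is_derive s 1 f d.
  have -> : (fun h => f (s + h)) = (fun h : R => f (s + h *: (1 : R))).
    by apply/funext => h; rewrite [h *: _]mulr1.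
  by rewrite -is_derive_line scale0r addr0.
have n0 : \forall h \near (0 : R), `|s + h| < r.
  have n1 : \forall h \near (0 : R), `|h| < r - `|s|.
    by apply: nbhs0_lt; rewrite subr_gt0.
  apply: filterS n1 => h hr; apply: le_lt_trans (ler_normD _ _) _.
  by rewrite -ltrBrDl.
apply: shift0.
have := @seg_int_param_derive _ 0 tau (fun t h => K t (s + h)) (fun t h => dK t (s + h)).
rewrite addr0; apply.
- exact: ltW.
- apply: filterS n0 => h hr t _.
  have := H1 _ t hr.
  have {1}-> : s + h = s + h *: (1 : R) by rewrite [h *: _]mulr1.
  move/is_derive_line.
  by under eq_fun do rewrite [_ *: _]mulr1.
- by apply: filterS n0 => h hr t _; exact: H2.
- move=> t _.
  have h : {for (t, 0 : R), continuous (fun q : R * R => (q.1, s + q.2))}.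
    apply: pair_continuous; first exact: fst_continuous.
    by apply: real_continuousD; [exact: real_continuous_cst|exact: snd_continuous].
  have h2 := H3 _ t sr; rewrite -[X in (t, X)]addr0 in h2.
  exact: (comp_continuous h h2).
Qed.

(** The derivative is asked for only inside the interval because the identities for circle means
    divide by the radius; continuity carries the value down to radius 0. *)
Lemma derive0_const (f : R -> R) r : 0 <= r ->
  (forall s, 0 < s < r -> is_derive s 1 f 0) ->
  (forall s, 0 <= s <= r -> {for s, continuous f}) -> f r = f 0.
Proof.
move=> r0 df cf.
have df0 (s : R) : s \in `]0, r[%R -> is_derive s 1 f 0.
  by rewrite in_itv /= => /df.
have [x _] := @MVT_segment _ f (fun=> 0) 0 r r0 df0 (seg_cont_within cf).
by rewrite mul0r => /eqP; rewrite subr_eq0 => /eqP.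
Qed.

End CauchyTheory.

(** * Means over circles *)

Section CauchyTheory.
Context {R : realType}.
Local Notation plane := (R^o * R^o)%type.
Implicit Types (D : set plane) (p z w e : plane) (u v a b f g : plane -> R).
Implicit Types (t r s x y : R).

Local Notation tau := ((pi : R) *+ 2).
Local Notation cint := (seg_int 0 tau).
#[local] Hint Extern 0 (is_true (0 < _ *+ _)) => exact: tau_gt0 : core.

Section Disc.
Variables (D : set plane) (u v a b : plane -> R) (z : plane) (r : R).
Hypotheses (oD : open D) (H : hol D u v a b).
Hypothesis discD : forall s t, `|s| < r -> D (circle z s t).

Let joint f s t : {for circle z s t, continuous f} ->
  {for (t, s), continuous (fun q : R * R => f (circle z q.2 q.1))}.
Proof.
move=> cf.
have h1 : {for (t, s), continuous (fun _ : R * R => z)} by exact: cst_continuous.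
have h2 : {for (t, s), continuous (fun q : R * R => q.2)} by exact: snd_continuous.
have h3 : {for (t, s), continuous (fun q : R * R => q.1)} by exact: fst_continuous.
have := circle_comp_continuous h1 h2 h3 cf.
by [].
Qed.

Let sect f s t : {for circle z s t, continuous f} ->
  {for t, continuous (fun t => f (circle z s t))}.
Proof.
move=> cf.
have h1 : {for t, continuous (fun _ : R => z)} by exact: cst_continuous.
have h2 : {for t, continuous (fun _ : R => s)} by exact: cst_continuous.
have h3 : {for t, continuous (fun t : R => t)} by exact: cvg_id.
have := circle_comp_continuous h1 h2 h3 cf.
by [].
Qed.

Let uvab s t : `|s| < r -> [/\ {for circle z s t, continuous u},
  {for circle z s t, continuous v}, {for circle z s t, continuous a} &
  {for circle z s t, continuous b}].
Proof.
move=> sr; have [? ?] := hol_continuous oD H (discD t sr).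
by have [_ _ _ _ []] := H (discD t sr).
Qed.

Let fst_cos (s t : R) : {for (t, s), continuous (fun q : R * R => cos q.1)}.
Proof. by apply: real_continuous_cos; exact: fst_continuous. Qed.

Let fst_sin (s t : R) : {for (t, s), continuous (fun q : R * R => sin q.1)}.
Proof. by apply: real_continuous_sin; exact: fst_continuous. Qed.

Let derive_continuous (f : R -> R) s d : is_derive s 1 f d -> {for s, continuous f}.
Proof.
by move=> fd; apply/differentiable_continuous/derivable1_diffP; exact: ex_derive.
Qed.

Lemma circle0 t : circle z 0 t = z.
Proof. by rewrite /circle !mul0r !addr0; case: (z). Qed.

(* The radial derivative of u and (1/r) times the angular derivative of v agree, and
   the latter integrates to 0 over a period. *)
Lemma hol_mean_value s : 0 <= s < r ->
  cint (fun t => u (circle z s t)) = u z * tau.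
Proof.
move=> /andP[s0 sr].
have nr (x : R) : 0 <= x <= s -> `|x| < r.
  by move=> /andP[x0 xs]; rewrite ger0_norm//; exact: le_lt_trans sr.
pose K t s := u (circle z s t).
pose dK t s := a (circle z s t) * cos t - b (circle z s t) * sin t.
have d1 (x t : R) : `|x| < r -> is_derive x 1 (K t) (dK t x).
  by move=> xr; have [] := hol_circle_radial oD H (discD t xr).
have cK (x t : R) : `|x| < r -> {for t, continuous (K ^~ x)}.
  by move=> xr; have [cu _ _ _] := uvab t xr; exact: (sect cu).
have cdK (x t : R) : `|x| < r -> {for (t, x), continuous (fun q => dK q.1 q.2)}.
  move=> xr; have [_ _ ca cb] := uvab t xr.
  have h1 := real_continuousM (joint ca) (@fst_cos x t).
  have h2 := real_continuousM (joint cb) (@fst_sin x t).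
  exact: (real_continuousB h1 h2).
have dphi := seg_int_derive_at d1 cK cdK.
have int0 (x : R) : 0 < x -> `|x| < r -> cint (dK ^~ x) = 0.
  move=> x0 xr.
  have dKc : seg_cont 0 tau (dK ^~ x).
    by apply: seg_cont_section => t _; exact: cdK.
  have xdKc : seg_cont 0 tau (fun t => x * dK t x).
    by apply: seg_contM => //; exact: seg_cont_cst.
  have dv (t : R) : 0 <= t <= tau ->
      is_derive t 1 (fun t => v (circle z x t)) (x * dK t x).
    move=> _; have [_ h] := hol_circle_angular oD H (discD t xr).
    by apply: is_derive_eq h _; rewrite /dK; ring.
  have : x * cint (dK ^~ x) = 0.
    by rewrite -seg_intZ// (seg_int_derive tau_gt0 dv)// circle_period subrr.
  by move=> /eqP; rewrite mulf_eq0 (gt_eqF x0) => /eqP.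
pose phi (y : R) := cint (K ^~ y).
have dphi0 (x : R) : 0 < x < s -> is_derive x 1 phi 0.
  move=> /andP[x0 xs]; have xr : `|x| < r by apply: nr; rewrite !ltW.
  by rewrite -(int0 x x0 xr); exact: dphi.
have cphi (x : R) : 0 <= x <= s -> {for x, continuous phi}.
  by move=> /nr xr; exact: derive_continuous (dphi _ xr).
rewrite -[LHS]/(phi s) (derive0_const s0 dphi0 cphi) /phi.
rewrite (@eq_seg_int _ _ _ _ (fun=> u z)); last by move=> t _; rewrite /K circle0.
by rewrite seg_int_cst ?subr0//; exact: ltW tau_gt0.
Qed.

(* For phi(r) the left-hand side and Psi(r) the integral of a over the circle of
   radius r, integration by parts in t gives phi = r Psi, while phi' = Psi; hence
   Psi is constant. *)
Lemma hol_mean_derive s : 0 < s < r ->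
  cint (fun t => u (circle z s t) * cos t + v (circle z s t) * sin t) = s * (a z * tau).
Proof.
move=> /andP[s0 sr].
have nr (x : R) : 0 <= x <= s -> `|x| < r.
  by move=> /andP[x0 xs]; rewrite ger0_norm//; exact: le_lt_trans sr.
pose K t s := u (circle z s t) * cos t + v (circle z s t) * sin t.
pose dK t s := a (circle z s t).
have d1 (x t : R) : `|x| < r -> is_derive x 1 (K t) (dK t x).
  move=> xr; have [hu hv] := hol_circle_radial oD H (discD t xr).
  have -> : K t = cos t *: (fun s => u (circle z s t)) + sin t *: (fun s => v (circle z s t)).
    by apply/funext => y; rewrite /K mulrC [X in _ + X]mulrC.
  apply: is_derive_eq (is_deriveD (is_deriveZ _ hu) (is_deriveZ _ hv)) _.
  rewrite !scaleRE; have := cos2Dsin2 t; rewrite /dK.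
  set A := a _; set B := b _ => E.
  transitivity (A * (cos t ^+ 2 + sin t ^+ 2)); first by ring.
  by rewrite E mulr1.
have cK (x t : R) : `|x| < r -> {for t, continuous (K ^~ x)}.
  move=> xr; have [cu cv _ _] := uvab t xr.
  have ct : {for t, continuous (@cos R)} by exact: continuous_cos.
  have st : {for t, continuous (@sin R)} by exact: continuous_sin.
  have h1 := real_continuousM (sect cu) ct.
  have h2 := real_continuousM (sect cv) st.
  exact: (real_continuousD h1 h2).
have cdK (x t : R) : `|x| < r -> {for (t, x), continuous (fun q => dK q.1 q.2)}.
  by move=> xr; have [_ _ ca _] := uvab t xr; exact: (joint ca).
have dphi := seg_int_derive_at d1 cK cdK.
have parts (x : R) : `|x| < r -> cint (K ^~ x) = x * cint (dK ^~ x).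
  move=> xr.
  have dKc : seg_cont 0 tau (dK ^~ x).
    by apply: seg_cont_section => t _; exact: cdK.
  have Kc : seg_cont 0 tau (K ^~ x) by move=> t _; exact: cK.
  have xdKc : seg_cont 0 tau (fun t => x * dK t x).
    by apply: seg_contM => //; exact: seg_cont_cst.
  have Fc : seg_cont 0 tau (fun t => K t x + - (x * dK t x)).
    by apply: seg_contD => //; exact: seg_contN.
  (* [K] is the real part of F e^{-it}, and the primitive is minus its imaginary part. *)
  have dF (t : R) : 0 <= t <= tau -> is_derive t 1
      (fun t => u (circle z x t) * sin t - v (circle z x t) * cos t)
      (K t x + - (x * dK t x)).
    move=> _; have [hu hv] := hol_circle_angular oD H (discD t xr).
    apply: is_derive_eq (is_deriveB (is_deriveM hu (is_derive_sin t))
      (is_deriveM hv (is_derive_cos t))) _.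
    rewrite !scaleRE; have := cos2Dsin2 t; rewrite /dK /K.
    set A := a _; set B := b _ => E.
    rewrite -[X in _ + - (x * X)]mulr1 -E; ring.
  apply/eqP; rewrite -subr_eq0 -seg_intZ// -seg_intN// -seg_intD//; last first.
    exact: seg_contN.
  by rewrite (seg_int_derive tau_gt0 dF)// circle_period cos2pi sin2pi cos0 sin0 subrr.
pose Psi (x : R) := cint (dK ^~ x).
have cPsi (x : R) : `|x| < r -> {for x, continuous Psi}.
  move=> xr; apply: seg_int_param_continuous.
  - exact: ltW.
  - have nx : \forall y \near x, `|y| < r.
      move: xr; rewrite ltr_norml => /andP[xr1 xr2].
      have n1 : \forall y \near x, - r < y by apply: lt_nbhsr.
      have n2 : \forall y \near x, y < r by apply: lt_nbhsl.
      near=> y; rewrite ltr_norml; apply/andP; split; by near: y.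
    apply: filterS nx => y yr; apply: seg_cont_section => t _; exact: cdK.
  - by move=> t _; exact: cdK.
rewrite -[LHS]/(cint (K ^~ s)) parts; last by apply: nr; rewrite lexx ltW.
congr (_ * _); rewrite -[LHS]/(Psi s).
have dPsi0 (x : R) : 0 < x < s -> is_derive x 1 Psi 0.
  move=> /andP[x0 xs]; have xr : `|x| < r by apply: nr; rewrite !ltW.
  have xn0 : x != 0 by rewrite gt_eqF.
  (* Away from 0, Psi is phi(y) / y, whose derivative (y phi' - phi) / y^2 vanishes because phi' =
     Psi and phi = y Psi. *)
  have dq : is_derive x 1 (fun y => cint (K ^~ y) * y^-1) 0.
    have iv : is_derive x 1 (fun y : R => y^-1) (- x ^- 2 * 1).
      by split; [exact: derivableV|rewrite (@deriveV _ _ id)// derive_val].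
    apply: is_derive_eq (is_deriveM (dphi _ xr) iv) _.
    rewrite !scaleRE parts//; field => //.
  apply: near_eq_is_derive dq.
  have n0 : \forall y \near x, 0 < y by apply: lt_nbhsr.
  have n1 : \forall y \near x, y < s by apply: lt_nbhsl.
  near=> y.
  have y0 : 0 < y by near: y.
  have ys : y < s by near: y.
  by rewrite parts ?nr ?ltW// mulrAC divff ?mul1r// gt_eqF.
have cPsi' (x : R) : 0 <= x <= s -> {for x, continuous Psi}.
  by move=> /nr xr; exact: cPsi.
rewrite (derive0_const (ltW s0) dPsi0 cPsi') /Psi.
rewrite (@eq_seg_int _ _ _ _ (fun=> a z)); last by move=> t _; rewrite /dK circle0.
by rewrite seg_int_cst ?subr0//; exact: ltW tau_gt0.
Unshelve. all: by end_near. Qed.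

End Disc.

End CauchyTheory.

(** * Regularity and factorisation of zeros *)

Section ZeroTheory.
Context {R : realType}.
Local Notation plane := (R^o * R^o)%type.
Implicit Types (D : set plane) (p z w e : plane) (u v a b f g : plane -> R).
Implicit Types (t r s x y : R).
Local Notation tau := ((pi : R) *+ 2).

Lemma hol_eq D u v u' v' a b : open D ->
  (forall z, D z -> u z = u' z) -> (forall z, D z -> v z = v' z) ->
  hol D u v a b -> hol D u' v' a b.
Proof.
move=> oD uu vv H z Dz; have nD : \forall w \near z, D w by exact: open_nbhs_nbhs.
have nu : \forall w \near z, u w = u' w by apply: filterS nD.
have nv : \forall w \near z, v w = v' w by apply: filterS nD.
have [ux uy vx vy cab] := H _ Dz.
split => //; [exact: near_eq_is_derive nu ux|exact: near_eq_is_derive nu uy|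
  exact: near_eq_is_derive nv vx|exact: near_eq_is_derive nv vy].
Qed.

(** Multiplication by -i: facts proved for real parts transfer to imaginary parts. *)
Lemma hol_rot D u v a b : hol D u v a b -> hol D v (fun z => - u z) b (fun z => - a z).
Proof.
move=> H z Dz; have [ux uy vx vy [ca cb]] := H _ Dz; split => //.
- by rewrite opprK.
- exact: (is_deriveN ux).
- by rewrite -[b z]opprK; exact: (is_deriveN uy).
- by split => //; exact: real_continuousN.
Qed.

(** The squared modulus avoids square roots and encodes the two equations u = v = 0 in one. *)
Definition nsq u v z := u z ^+ 2 + v z ^+ 2.

Lemma nsq_ge0 u v z : 0 <= nsq u v z.
Proof. by rewrite addr_ge0 ?sqr_ge0. Qed.

Lemma nsq_continuous u v z : {for z, continuous u} -> {for z, continuous v} ->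
  {for z, continuous (nsq u v)}.
Proof.
move=> cu cv.
have h := real_continuousD (real_continuousM cu cu) (real_continuousM cv cv).
exact: h.
Qed.

Lemma circle_section_continuous f z s t : {for circle z s t, continuous f} ->
  {for t, continuous (fun t => f (circle z s t))}.
Proof.
move=> cf.
have h1 : {for t, continuous (fun _ : R => z)} by exact: cst_continuous.
have h2 : {for t, continuous (fun _ : R => s)} by exact: cst_continuous.
have h3 : {for t, continuous (fun t : R => t)} by exact: cvg_id.
have := circle_comp_continuous h1 h2 h3 cf.
by [].
Qed.

(** The mean value property for conj(F(z)) F, whose real part at the centre is |F(z)|^2, gives a
    point w of the circle where |F(z)|^2 <= Re(conj(F(z)) F(w)). Expanding |F(z) - F(w)|^2 >= 0 then
    yields |F(z)| <= |F(w)|. *)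
Lemma hol_max_circle D u v a b z r s : open D -> hol D u v a b ->
  (forall s t, `|s| < r -> D (circle z s t)) -> 0 <= s < r ->
  exists2 t, 0 <= t <= tau & nsq u v z <= nsq u v (circle z s t).
Proof.
move=> oD H discD sr.
have sr' : `|s| < r by case/andP: sr => s0 sr; rewrite ger0_norm.
have H' := hol_mul oD (@hol_cst R D (u z) (- v z)) H.
have := hol_mean_value oD H' discD sr.
set U := (fun t => _ - _) => EU.
have cU : seg_cont 0 tau U.
  move=> t _; have [cu cv] := hol_continuous oD H (discD s t sr').
  have h1 := circle_section_continuous cu; have h2 := circle_section_continuous cv.
  have h3 := real_continuousM (@real_continuous_cst _ _ (u z) t) h1.
  have h4 := real_continuousM (@real_continuous_cst _ _ (- v z) t) h2.
  exact: (real_continuousB h3 h4).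
have [t] := EVT_max (ltW tau_gt0) (seg_cont_within cU).
rewrite in_itv /= => t0 tM; exists t => //.
have UM x : 0 <= x <= tau -> U x <= U t by move=> x0; apply: tM; rewrite in_itv.
have := le_seg_int cU (@seg_cont_cst _ _ _ (U t)) UM.
rewrite EU (seg_int_cst _ (ltW tau_gt0)) subr0.
rewrite ler_pM2r ?tau_gt0// /U /nsq => le.
set A := u z in le *; set B := v z in le *.
set C := u _ in le *; set E := v _ in le *.
have {}le : A ^+ 2 + B ^+ 2 <= A * C + B * E.
  by move: le; rewrite !mulNr !opprK -!expr2.
have := sqr_ge0 (A - C); have := sqr_ge0 (B - E).
have -> : (A - C) ^+ 2 = A ^+ 2 - A * C *+ 2 + C ^+ 2 by ring.
have -> : (B - E) ^+ 2 = B ^+ 2 - B * E *+ 2 + E ^+ 2 by ring.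
lra.
Qed.

Lemma plane_ballE z r w : ball z r w <-> `|z.1 - w.1| < r /\ `|z.2 - w.2| < r.
Proof. by []. Qed.

(** Balls of the product are open squares, so each coordinate of the displacement is bounded
    separately. *)
Lemma circle_in_ball p z r s t : `|s| <= r -> ball p r z -> ball p (r + r) (circle z s t).
Proof.
move=> sr /plane_ballE[z1 z2]; apply/plane_ballE; rewrite /circle /= !opprD !addrA.
have cs (c : R) : `|c| <= 1 -> `|s * c| <= r.
  by move=> c1; rewrite normrM (le_trans _ sr)// ler_piMr.
split; apply: (le_lt_trans (ler_normB _ _)); apply: ltr_leD => //; apply: cs.
  by rewrite ler_norml cos_geN1 cos_le1.
by rewrite ler_norml sin_geN1 sin_le1.
Qed.

Lemma hol_translate D D' u v a b w : open D -> hol D u v a b ->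
  (forall z, D' z -> D (z.1 + w.1, z.2 + w.2)) ->
  hol D' (fun z => u (z.1 + w.1, z.2 + w.2)) (fun z => v (z.1 + w.1, z.2 + w.2))
         (fun z => a (z.1 + w.1, z.2 + w.2)) (fun z => b (z.1 + w.1, z.2 + w.2)).
Proof.
move=> oD H DD.
have E z : (w.1 + 1 * z.1, w.2 + 1 * 1 * z.2) = (z.1 + w.1, z.2 + w.2) :> plane.
  by rewrite !mul1r addrC [w.2 + _]addrC.
have -> : (fun z => u (z.1 + w.1, z.2 + w.2)) =
    (fun z => u (w.1 + 1 * z.1, w.2 + 1 * 1 * z.2)) by apply/funext => z; rewrite E.
have -> : (fun z => v (z.1 + w.1, z.2 + w.2)) =
    (fun z => 1 * v (w.1 + 1 * z.1, w.2 + 1 * 1 * z.2)).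
  by apply/funext => z; rewrite E mul1r.
have -> : (fun z => a (z.1 + w.1, z.2 + w.2)) =
    (fun z => 1 * a (w.1 + 1 * z.1, w.2 + 1 * 1 * z.2)).
  by apply/funext => z; rewrite E mul1r.
have -> : (fun z => b (z.1 + w.1, z.2 + w.2)) =
    (fun z => 1 * 1 * b (w.1 + 1 * z.1, w.2 + 1 * 1 * z.2)).
  by apply/funext => z; rewrite E !mul1r.
by apply: (hol_affine oD _ H); [left|move=> z /DD; rewrite E].
Qed.

Lemma circle_cos_sin_continuous f g z s t : {for circle z s t, continuous f} ->
  {for circle z s t, continuous g} ->
  {for t, continuous (fun t => f (circle z s t) * cos t + g (circle z s t) * sin t)}.
Proof.
move=> cf cg.
have h1 := circle_section_continuous cf; have h2 := circle_section_continuous cg.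
have ct : {for t, continuous (@cos R)} by exact: continuous_cos.
have st : {for t, continuous (@sin R)} by exact: continuous_sin.
exact: (real_continuousD (real_continuousM h1 ct) (real_continuousM h2 st)).
Qed.

(* [hol_mean_derive] writes g' as a mean of g over circles of a fixed radius, so g' is
   as smooth as g. *)
Lemma hol_derive_hol_local D D' u v a b r : open D -> open D' -> 0 < r ->
  hol D u v a b -> (forall z s t, D' z -> `|s| < r -> D (circle z s t)) ->
  exists a2 b2, hol D' a b a2 b2.
Proof.
move=> oD oD' r0 H discD.
pose s := r / 2; have s0 : 0 < s by rewrite divr_gt0.
have sr : s < r by rewrite /s; lra.
have sr' : `|s| < r by rewrite gtr0_norm.
pose c := (s * tau)^-1.
have c0 : s * tau != 0 by rewrite mulf_neq0 ?gt_eqF ?tau_gt0.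
(* [U t + i V t] is c e^{-it} F(z + s e^{it}), the integrand of Cauchy's formula for F'. The null
   summands in [A] and [B] are those that [hol_mul] creates for a constant factor. *)
pose U t z := c * (u (circle z s t) * cos t + v (circle z s t) * sin t).
pose V t z := c * (v (circle z s t) * cos t + - u (circle z s t) * sin t).
pose A t z := a (circle z s t) * (c * cos t) + u (circle z s t) * 0 -
  (b (circle z s t) * (c * - sin t) + v (circle z s t) * 0).
pose B t z := a (circle z s t) * (c * - sin t) + u (circle z s t) * 0 +
  (b (circle z s t) * (c * cos t) + v (circle z s t) * 0).
have Hc t : hol D' (U t) (V t) (A t) (B t).
  have H1 : hol D' (fun z => u (circle z s t)) (fun z => v (circle z s t))
      (fun z => a (circle z s t)) (fun z => b (circle z s t)).
    apply: (@hol_translate D D' u v a b (s * cos t, s * sin t)) => // z Dz.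
    exact: (discD z s t).
  apply: hol_eq (hol_mul oD' H1 (@hol_cst R D' (c * cos t) (c * - sin t))) => //.
    by move=> z _; rewrite /U; ring.
  by move=> z _; rewrite /V; ring.
have joint f t z : {for circle z s t, continuous f} ->
    {for (t, z), continuous (fun q : R * plane => f (circle q.2 s q.1))}.
  move=> cf.
  have h1 : {for (t, z), continuous (fun q : R * plane => q.2)} by exact: snd_continuous.
  have h2 : {for (t, z), continuous (fun _ : R * plane => s)} by exact: cst_continuous.
  have h3 : {for (t, z), continuous (fun q : R * plane => q.1)} by exact: fst_continuous.
  have := circle_comp_continuous h1 h2 h3 cf.
  by [].
have trig t z : {for (t, z), continuous (fun q : R * plane => c * cos q.1)} /\
    {for (t, z), continuous (fun q : R * plane => c * - sin q.1)}.
  have h3 : {for (t, z), continuous (fun q : R * plane => q.1)} by exact: fst_continuous.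
  have h4 := @real_continuous_cst _ _ c ((t, z) : R * plane).
  have h5 := real_continuousM h4 (real_continuous_cos h3).
  have h6 := real_continuousM h4 (real_continuousN (real_continuous_sin h3)).
  by split; [exact: h5|exact: h6].
have AB t z : D' z -> {for (t, z), continuous (fun q : R * plane => A q.1 q.2)} /\
    {for (t, z), continuous (fun q : R * plane => B q.1 q.2)}.
  move=> Dz; have Dc := discD z s t Dz sr'.
  have [cu cv] := hol_continuous oD H Dc; have [_ _ _ _ [ca cb]] := H _ Dc.
  have [tc ts] := trig t z.
  have z0 := @real_continuous_cst _ _ (0 : R) ((t, z) : R * plane).
  have h1 := real_continuousM (joint _ _ _ ca) tc.
  have h2 := real_continuousM (joint _ _ _ ca) ts.
  have h3 := real_continuousM (joint _ _ _ cb) tc.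
  have h4 := real_continuousM (joint _ _ _ cb) ts.
  have h5 := real_continuousM (joint _ _ _ cu) z0.
  have h6 := real_continuousM (joint _ _ _ cv) z0.
  split.
    exact: (real_continuousB (real_continuousD h1 h5) (real_continuousD h4 h6)).
  exact: (real_continuousD (real_continuousD h2 h5) (real_continuousD h3 h6)).
have cs1 z : D' z -> seg_cont 0 tau
    (fun t => u (circle z s t) * cos t + v (circle z s t) * sin t).
  move=> Dz t _; have Dc := discD z s t Dz sr'.
  by have [cu cv] := hol_continuous oD H Dc; exact: circle_cos_sin_continuous.
have cs2 z : D' z -> seg_cont 0 tau
    (fun t => v (circle z s t) * cos t + - u (circle z s t) * sin t).
  move=> Dz t _; have Dc := discD z s t Dz sr'.
  have [cu cv] := hol_continuous oD (hol_rot H) Dc.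
  exact: (@circle_cos_sin_continuous v (fun z => - u z)).
have UV z : D' z -> seg_cont 0 tau (U ^~ z) /\ seg_cont 0 tau (V ^~ z).
  by move=> Dz; split; apply: seg_contM; [exact: seg_cont_cst|exact: cs1|
    exact: seg_cont_cst|exact: cs2].
have := @hol_seg_int R D' 0 tau U V A B (ltW tau_gt0) oD' (fun t _ => Hc t) UV
  (fun t z _ => @AB t z).
move=> Hint; eexists; eexists; apply: hol_eq Hint => //.
- move=> z Dz; have := @hol_mean_derive R D u v a b z r oD H (fun s t => discD z s t Dz) s.
  rewrite s0 sr => /(_ isT) E.
  rewrite /U seg_intZ; last exact: cs1.
  by rewrite E [s * _]mulrCA [c * _]mulrCA mulVf// mulr1.
(* The imaginary part of F' comes from the same formula applied to -i F. *)
- move=> z Dz; have := @hol_mean_derive R D v (fun z => - u z) b (fun z => - a z) z r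
    oD (hol_rot H) (fun s t => discD z s t Dz) s.
  rewrite s0 sr => /(_ isT) E.
  rewrite /V seg_intZ; last exact: cs2.
  by rewrite E [s * _]mulrCA [c * _]mulrCA mulVf// mulr1.
Qed.

End ZeroTheory.

(** * Differentiability of the derivative and division by z - p *)

Section Zeros.
Context {R : realType}.
Local Notation plane := (R^o * R^o)%type.
Local Notation dx := (dir_x R).
Implicit Types (D : set plane) (p z w e : plane) (u v a b f g : plane -> R).
Implicit Types (t r s x y : R).

Lemma open_plane_ball z r : open (ball z r : set plane).
Proof. exact: (@ball_open R (R^o * R^o)%type). Qed.

Lemma open_ball_sub D z : open D -> D z -> exists2 r : R, 0 < r & ball z r `<=` D.
Proof.
move=> oD Dz; have : nbhs z D by exact: open_nbhs_nbhs.
by move=> /nbhs_ballP[r /= r0 rD]; exists r.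
Qed.

Lemma near_eq_continuous (T : topologicalType) (f g : T -> R) (x : T) :
  (\forall y \near x, f y = g y) -> {for x, continuous f} ->
  {for x, continuous g}.
Proof.
move=> fg cf A; rewrite -(nbhs_singleton fg) => /cf.
by apply: filterS2 fg => y E Af; rewrite /= -E.
Qed.

(** The local version gives second derivatives on a ball that depends on the point; naming them by
    ['D_dx] glues them into one pair of functions on [D]. Halving the radius keeps the circles used
    inside the larger ball. *)
Lemma hol_derive_hol D u v a b : open D -> hol D u v a b ->
  hol D a b ('D_dx a) ('D_dx b).
Proof.
move=> oD H z Dz; have [r r0 rD] := open_ball_sub oD Dz.
have r2 : 0 < r / 2 by rewrite divr_gt0.
have [a2 [b2 H2]] : exists a2 b2, hol (ball z (r / 2)) a b a2 b2.
  apply: (@hol_derive_hol_local R (ball z r)) r2 (hol_sub rD H) _.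
  - exact: open_plane_ball.
  - exact: open_plane_ball.
  - move=> w s t wz sr; have -> : r = r / 2 + r / 2 by lra.
    by apply: circle_in_ball => //; exact: ltW.
have nz : \forall w \near z, ball z (r / 2) w by exact: nbhsx_ballx.
have ea : \forall w \near z, a2 w = 'D_dx a w.
  by apply: filterS nz => w /H2[ax _ _ _ _]; rewrite derive_val.
have eb : \forall w \near z, b2 w = 'D_dx b w.
  by apply: filterS nz => w /H2[_ _ bx _ _]; rewrite derive_val.
have [ax ay bx b_y [ca cb]] := H2 z (ballxx z r2).
rewrite -(nbhs_singleton ea) -(nbhs_singleton eb); split => //.
by split; [exact: near_eq_continuous ea ca|exact: near_eq_continuous eb cb].
Qed.

Lemma seg_int_lin (f g : R -> R) (c d x y : R) :
  seg_cont c d f -> seg_cont c d g ->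
  seg_int c d (fun t => x * f t + y * g t) = x * seg_int c d f + y * seg_int c d g.
Proof.
move=> cf cg; rewrite -!seg_intZ// -seg_intD//;
  by apply: seg_contM => //; exact: seg_cont_cst.
Qed.

(* The quotient h = (g - g(p)) / (z - p) is the mean of g' over the segment [p, z]. *)
Lemma hol_divide D u v a b p : open D -> hol D u v a b -> D p ->
  (forall z t, D z -> 0 <= t <= 1 ->
     D ((1 - t) * p.1 + t * z.1, (1 - t) * p.2 + t * z.2)) ->
  u p = 0 -> v p = 0 ->
  exists h1 h2 c1 c2, hol D h1 h2 c1 c2 /\
    forall z, D z -> u z = (z.1 - p.1) * h1 z - (z.2 - p.2) * h2 z /\
                     v z = (z.1 - p.1) * h2 z + (z.2 - p.2) * h1 z.
Proof.
move=> oD H Dp star u0 v0.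
pose m t z : plane := ((1 - t) * p.1 + t * z.1, (1 - t) * p.2 + t * z.2).
have H' := hol_derive_hol oD H.
set a2 := 'D_dx a in H'; set b2 := 'D_dx b in H'.
pose Ut t z := a (m t z); pose Vt t z := b (m t z).
pose At t z := t * a2 (m t z); pose Bt t z := t * b2 (m t z).
have Hc t : 0 <= t <= 1 -> hol D (Ut t) (Vt t) (At t) (Bt t).
  move=> t01.
  have E z : m t z = ((1 - t) * p.1 + t * z.1, (1 - t) * p.2 + 1 * t * z.2).
    by rewrite /m mul1r.
  have -> : Ut t = (fun z => a ((1 - t) * p.1 + t * z.1, (1 - t) * p.2 + 1 * t * z.2)).
    by apply/funext => z; rewrite -E.
  have -> : Vt t = (fun z => 1 * b ((1 - t) * p.1 + t * z.1, (1 - t) * p.2 + 1 * t * z.2)).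
    by apply/funext => z; rewrite -E mul1r.
  have -> : At t = (fun z => t * a2 ((1 - t) * p.1 + t * z.1, (1 - t) * p.2 + 1 * t * z.2)).
    by apply/funext => z; rewrite -E.
  have -> : Bt t = (fun z => 1 * t * b2 ((1 - t) * p.1 + t * z.1, (1 - t) * p.2 + 1 * t * z.2)).
    by apply/funext => z; rewrite -E mul1r.
  apply: (@hol_affine R D D a b a2 b2 t 1 ((1 - t) * p.1, (1 - t) * p.2)) => //.
    by left.
  by move=> z Dz; rewrite mul1r; exact: star.
have joint f t z : {for m t z, continuous f} ->
    {for (t, z), continuous (fun q : R * plane => f (m q.1 q.2))}.
  move=> cf.
  have h1 : {for (t, z), continuous (fun q : R * plane => q.1)} by exact: fst_continuous.
  have h2 : {for (t, z), continuous (fun q : R * plane => q.2)} by exact: snd_continuous.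
  have h3 : {for (t, z), continuous (fun q : R * plane => q.2.1 : R)}.
    have h := @comp_continuous (R * plane)%type plane R (fun q => q.2) (fun z => z.1 : R) (t, z) h2.
    by apply: h; exact: plane_fst_continuous.
  have h4 : {for (t, z), continuous (fun q : R * plane => q.2.2 : R)}.
    have h := @comp_continuous (R * plane)%type plane R (fun q => q.2) (fun z => z.2 : R) (t, z) h2.
    by apply: h; exact: plane_snd_continuous.
  have cc c := @real_continuous_cst _ _ (c : R) ((t, z) : R * plane).
  have h5 c := real_continuousM (real_continuousB (cc 1) h1) (cc c).
  have h6 := real_continuousD (h5 p.1) (real_continuousM h1 h3).
  have h7 := real_continuousD (h5 p.2) (real_continuousM h1 h4).
  have h8 := pair_continuous h6 h7.
  exact: (comp_continuous h8 cf).
have jsect f t z : {for m t z, continuous f} -> {for t, continuous (fun t => f (m t z))}.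
  move=> /(@joint f t z) h.
  have h1 : {for t, continuous (fun t : R => (t, z))}.
    by apply: pair_continuous; [exact: cvg_id|exact: cvg_cst].
  exact: (comp_continuous h1 h).
have AB t z : 0 <= t <= 1 -> D z ->
    {for (t, z), continuous (fun q : R * plane => At q.1 q.2)} /\
    {for (t, z), continuous (fun q : R * plane => Bt q.1 q.2)}.
  move=> t01 Dz; have [_ _ _ _ [ca cb]] := H' _ (star z t Dz t01).
  have h1 : {for (t, z), continuous (fun q : R * plane => q.1)} by exact: fst_continuous.
  split; [exact: (real_continuousM h1 (joint _ _ _ ca))|].
  exact: (real_continuousM h1 (joint _ _ _ cb)).
have UV z : D z -> seg_cont 0 1 (Ut ^~ z) /\ seg_cont 0 1 (Vt ^~ z).
  move=> Dz; split => t t01; have [_ _ _ _ [ca cb]] := H _ (star z t Dz t01).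
    exact: (jsect _ _ _ ca).
  exact: (jsect _ _ _ cb).
have Hint := @hol_seg_int R D 0 1 Ut Vt At Bt ler01 oD Hc UV AB.
do 4! eexists; split; first exact: Hint.
move=> z Dz /=.
have [cU cV] := UV z Dz.
have m0 : m 0 z = p by rewrite /m !mul0r subr0 !mul1r !addr0; case: (p).
have m1 : m 1 z = z by rewrite /m subrr !mul0r !mul1r !add0r; case: (z).
have lin (c d t : R) : is_derive t 1 (fun t => (1 - t) * c + t * d) (d - c).
  have -> : (fun t => (1 - t) * c + t * d) = (cst c + (d - c) \*: id : R -> R).
    by apply/funext => x; rewrite !fctE /= scaleRE; ring.
  by apply: is_derive_eq; rewrite add0r [LHS]mulr1.
have D1 t : 0 <= t <= 1 ->
    is_derive t 1 (fun t => u (m t z)) (Ut t z * (z.1 - p.1) - Vt t z * (z.2 - p.2)) /\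
    is_derive t 1 (fun t => v (m t z)) (Vt t z * (z.1 - p.1) + Ut t z * (z.2 - p.2)).
  move=> t01; have Dm := star z t Dz t01.
  exact: (@hol_curve R D u v a b (fun t => (1 - t) * p.1 + t * z.1)
    (fun t => (1 - t) * p.2 + t * z.2) t _ _ oD H Dm (lin p.1 z.1 t) (lin p.2 z.2 t)).
split.
  have d1 t : 0 <= t <= 1 -> is_derive t 1 (fun t => u (m t z))
      ((z.1 - p.1) * Ut t z + - (z.2 - p.2) * Vt t z).
    by move=> /D1[d1 _]; apply: is_derive_eq d1 _; ring.
  have cd : seg_cont 0 1 (fun t => (z.1 - p.1) * Ut t z + - (z.2 - p.2) * Vt t z).
    by apply: seg_contD; apply: seg_contM => //; exact: seg_cont_cst.
  have := seg_int_derive ltr01 d1 cd; rewrite m1 m0 u0 subr0 => <-.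
  by rewrite seg_int_lin// mulNr.
have d1 t : 0 <= t <= 1 -> is_derive t 1 (fun t => v (m t z))
    ((z.1 - p.1) * Vt t z + (z.2 - p.2) * Ut t z).
  by move=> /D1[_ d1]; apply: is_derive_eq d1 _; ring.
have cd : seg_cont 0 1 (fun t => (z.1 - p.1) * Vt t z + (z.2 - p.2) * Ut t z).
  by apply: seg_contD; apply: seg_contM => //; exact: seg_cont_cst.
have := seg_int_derive ltr01 d1 cd; rewrite m1 m0 v0 subr0 => <-.
by rewrite seg_int_lin.
Qed.

End Zeros.

(** * Isolated zeros, the identity principle and persistence of zeros *)

Section Identity.
Context {R : realType}.
Local Notation plane := (R^o * R^o)%type.
Implicit Types (D : set plane) (p z w e : plane) (u v a b f g : plane -> R).
Implicit Types (t r s x y : R).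
Local Notation tau := ((pi : R) *+ 2).

Lemma nbhs_ball_sub (P : set plane) z : nbhs z P ->
  exists2 r : R, 0 < r & forall w, ball z r w -> P w.
Proof. by move=> /nbhs_ballP[r /= r0 rP]; exists r. Qed.

Lemma near_gt0 (T : topologicalType) (f : T -> R) (x : T) :
  {for x, continuous f} -> 0 < f x -> \forall y \near x, 0 < f y.
Proof. by move=> cf f0; exact: (cf _ (lt_nbhsr f0)). Qed.

(* If every quotient g / (z - p)^k extends across p, the maximum principle on a circle
   around z bounds |g(z)|^2 by M / 16^k for all k. *)
Lemma hol_zero_dichotomy D u v a b p : open D -> hol D u v a b -> D p ->
  (\forall z \near p, nsq u v z = 0) \/
  (\forall z \near p, z <> p -> nsq u v z <> 0).
Proof.
move=> oD H Dp; have [r r0 rD] := open_ball_sub oD Dp.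
pose B : set plane := ball p r.
have oB : open B by exact: open_plane_ball.
have Bp : B p by exact: ballxx.
have HB := hol_sub rD H.
pose d z : R := (z.1 - p.1) ^+ 2 + (z.2 - p.2) ^+ 2.
have d_neq0 z : z <> p -> d z != 0.
  move=> zp; apply/negP; rewrite /d paddr_eq0 ?sqr_ge0// !sqrf_eq0 !subr_eq0.
  by move=> /andP[/eqP e1 /eqP e2]; apply: zp; case: z e1 e2 => z1 z2 /= -> ->; case: (p).
(* [h1 + i h2] plays the role of g / (z - p)^k; only the relation between moduli is recorded, which
   is all that the estimates use. *)
pose P k h1 h2 := (exists c1 c2, hol B h1 h2 c1 c2) /\
  forall z, B z -> nsq u v z = d z ^+ k * nsq h1 h2 z.
have star z t : B z -> 0 <= t <= 1 ->
     B ((1 - t) * p.1 + t * z.1, (1 - t) * p.2 + t * z.2).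
  move=> /plane_ballE[z1 z2] /andP[t0 t1]; apply/plane_ballE => /=.
  have e (x y : R) : x - ((1 - t) * x + t * y) = t * (x - y) by ring.
  rewrite !e !normrM (ger0_norm t0).
  by split; [apply: le_lt_trans z1|apply: le_lt_trans z2]; rewrite ler_piMl.
(* Either some quotient is nonzero at [p], and then the zero, if any, is isolated, or division by z
   - p never stops. *)
have [[k [h1 [h2 [[[c1 [c2 Hh]] E] hp]]]]|nP] :=
    pselect (exists k h1 h2, P k h1 h2 /\ nsq h1 h2 p != 0).
  right.
  have [ch1 ch2] := hol_continuous oB Hh Bp.
  have hp0 : 0 < nsq h1 h2 p by rewrite lt_def hp nsq_ge0.
  have nh := near_gt0 (nsq_continuous ch1 ch2) hp0.
  have nB : \forall z \near p, B z by exact: open_nbhs_nbhs.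
  apply: filterS2 nh nB => z hz Bz zp; rewrite E//; apply/eqP.
  by rewrite mulf_neq0 ?expf_neq0 ?d_neq0// gt_eqF.
have allP k : exists h1 h2, P k h1 h2.
  elim: k => [|k [h1 [h2 [[c1 [c2 Hh]] E]]]].
    exists u, v; split; first by exists a, b.
    by move=> z _; rewrite expr0 mul1r.
  have hp : nsq h1 h2 p = 0.
    apply: contrapT => /eqP hp; apply: nP; exists k, h1, h2; split => //.
    by split => //; exists c1, c2.
  have /andP[/eqP h10 /eqP h20] : (h1 p == 0) && (h2 p == 0).
    by move/eqP: hp; rewrite /nsq paddr_eq0 ?sqr_ge0// !sqrf_eq0.
  have [g1 [g2 [e1 [e2 [Hg Eg]]]]] := hol_divide oB Hh Bp star h10 h20.
  exists g1, g2; split; first by exists e1, e2.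
  move=> z Bz; rewrite E// exprSr -mulrA; congr (_ * _).
  by rewrite /nsq; have [-> ->] := Eg z Bz; rewrite /d; ring.
left.
(* For [z] in this square, [d z <= 2 (r/16)^2 = r^2 / 128], while on the circle of radius [r / 2]
   about [z] one has [d >= r^2/4 - r^2/8 = r^2 / 8]; the ratio is at least 16. The discs of radius
   below [3 r / 4] about [z] stay in [B]. *)
have r16 : 0 < r / 16 by rewrite divr_gt0.
have nz : \forall z \near p, ball p (r / 16) z by exact: nbhsx_ballx.
apply: filterS nz => z /plane_ballE[]; rewrite !ltr_norml => /andP[z1 z2] /andP[z3 z4].
have Bz : B z by apply/plane_ballE; rewrite !ltr_norml; split; apply/andP; split; lra.
have discB s t : `|s| < r * (3 / 4) -> B (circle z s t).
  move=> sr; apply/plane_ballE; rewrite /circle /= !opprD !addrA.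
  have cs (c : R) : `|c| <= 1 -> `|s * c| < r * (3 / 4).
    by move=> c1; rewrite normrM (le_lt_trans _ sr)// ler_piMr.
  have := cs (cos t); have := cs (sin t); rewrite !ler_norml cos_geN1 cos_le1 sin_geN1 sin_le1.
  move=> /(_ isT) + /(_ isT); rewrite !ltr_norml => /andP[? ?] /andP[? ?].
  by split; apply/andP; split; lra.
have s34 : 0 <= r / 2 < r * (3 / 4) by apply/andP; split; lra.
have s34' : `|r / 2| < r * (3 / 4) by rewrite ger0_norm; case/andP: s34.
pose N t := nsq u v (circle z (r / 2) t).
have cN : seg_cont 0 tau N.
  move=> t _; have [cu cv] := hol_continuous oB HB (discB _ t s34').
  exact: (circle_section_continuous (nsq_continuous cu cv)).
have [t0 _ tM] := EVT_max (ltW tau_gt0) (seg_cont_within cN).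
pose M := N t0.
have dz : 0 <= d z <= r ^+ 2 / 128.
  rewrite addr_ge0 ?sqr_ge0//= /d.
  have e x y : - (r / 16) < x - y < r / 16 -> (y - x) ^+ 2 <= r ^+ 2 / 256.
    move=> /andP[x1 x2]; have : 0 <= (r / 16 - (y - x)) * (r / 16 + (y - x)).
      by apply: mulr_ge0; lra.
    have -> : (r / 16 - (y - x)) * (r / 16 + (y - x)) = r ^+ 2 / 256 - (y - x) ^+ 2.
      by field.
    by rewrite subr_ge0.
  have := e p.1 z.1; have := e p.2 z.2; rewrite z1 z2 z3 z4 => /(_ isT) + /(_ isT).
  lra.
have dw t : r ^+ 2 / 8 <= d (circle z (r / 2) t).
  rewrite /d /circle /=.
  have := cos2Dsin2 t; have := cos_geN1 t; have := cos_le1 t.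
  have := sin_geN1 t; have := sin_le1 t.
  set C := cos t; set S := sin t => S1 S2 C1 C2 CS.
  have -> : (z.1 + r / 2 * C - p.1) ^+ 2 + (z.2 + r / 2 * S - p.2) ^+ 2 =
    (z.1 - p.1) ^+ 2 + (z.2 - p.2) ^+ 2 + r * (C * (z.1 - p.1) + S * (z.2 - p.2)) +
    r ^+ 2 / 4 * (C ^+ 2 + S ^+ 2) by field.
  rewrite CS mulr1.
  have e (c x y : R) : c <= 1 -> -1 <= c -> - (r / 16) < x - y -> x - y < r / 16 ->
     - (r / 16) <= c * (y - x).
    move=> c1 c2 x1 x2.
    (* The two products add up to [2 (r / 16 + c (y - x))], which makes the bound on the nonlinear
       term available to [lra]. *)
    have h1 : 0 <= (1 - c) * (r / 16 - (y - x)) by apply: mulr_ge0; lra.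
    have h2 : 0 <= (1 + c) * (r / 16 + (y - x)) by apply: mulr_ge0; lra.
    by lra.
  have k1 := e C p.1 z.1 C1 C2 z1 z2; have k2 := e S p.2 z.2 S1 S2 z3 z4.
  have : 0 <= r * (r / 8 + (C * (z.1 - p.1) + S * (z.2 - p.2))).
    by apply: mulr_ge0; lra.
  have := sqr_ge0 (z.1 - p.1); have := sqr_ge0 (z.2 - p.2).
  rewrite mulrDr expr2; lra.
(* With w the point that the maximum principle gives for the k-th quotient h: 16^k |g(z)|^2 = (16
   d(z))^k |h(z)|^2 <= d(w)^k |h(w)|^2 = |g(w)|^2 <= M. *)
have key k : 16 ^+ k * nsq u v z <= M.
  have [h1 [h2 [[c1 [c2 Hh]] E]]] := allP k.
  have [t t01 le] := hol_max_circle oB Hh discB s34.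
  have := tM t; rewrite in_itv /= => /(_ t01); apply: le_trans.
  rewrite /N E// E; last exact: discB.
  have dz0 : 0 <= 16 * d z by apply: mulr_ge0 => //; case/andP: dz.
  have dw0 := dw t.
  have dzw : 16 * d z <= d (circle z (r / 2) t) by case/andP: dz; lra.
  rewrite mulrA -exprMn; apply: ler_pM => //.
  - exact: exprn_ge0.
  - exact: nsq_ge0.
  - by rewrite lerXn2r ?nnegrE// (le_trans dz0).
apply: contrapT => /eqP nz0.
have c0 : 0 < nsq u v z by rewrite lt_def nz0 nsq_ge0.
have M0 : 0 <= M by exact: nsq_ge0.
have := archi_boundP (divr_ge0 M0 (ltW c0)).
set k := Num.bound _; rewrite ltr_pdivrMr// => Mk.
have := key k; rewrite leNgt => /negP; apply; apply: (lt_le_trans Mk).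
by rewrite (ler_wpM2r (ltW c0))// -natrX ler_nat ltnW// ltn_expl.
Qed.

(** By the dichotomy, the points of [D] near which F is not identically zero form an open set [E].
    The interior of the zero set is thus both open and closed in [D]. *)
Lemma hol_identity D u v a b z0 : open D -> connected D -> hol D u v a b ->
  D z0 -> (\forall z \near z0, nsq u v z = 0) ->
  forall z, D z -> nsq u v z = 0.
Proof.
move=> oD cD H Dz0 n0.
pose Z : set plane := [set z | nsq u v z = 0].
pose E : set plane := [set z | D z /\ ~ nbhs z Z].
pose B := D `&` interior Z.
have oE : open E.
  rewrite openE => z [Dz nz]; have [//|pz] := hol_zero_dichotomy oD H Dz.
  have nD : \forall w \near z, D w by exact: open_nbhs_nbhs.
  apply: filterS2 pz nD => w wz Dw; split => //.
  have [->//|wz' nw] := pselect (w = z).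
  exact: wz (nbhs_singleton nw).
have BE : B = D.
  apply: cD.
  - by exists z0; split.
  - by exists (interior Z) => //; exact: open_interior.
  - exists (~` E); first exact: open_closedC.
    apply/seteqP; split=> z [Dz]; first by move=> nz; split => // -[].
    by move=> /= nE; split => //; apply: contrapT => nz; exact: nE.
move=> z; rewrite -BE => -[_ nz]; exact: (nbhs_singleton nz).
Qed.

(** Openness of [D] puts a real interval around [x0] inside it, so the zeros accumulate at [x0] and
    the isolated case is excluded. *)
Lemma hol_identity_real D u v a b (x0 : R) : open D -> connected D -> hol D u v a b ->
  D (x0, 0) -> (forall x : R, D (x, 0) -> nsq u v (x, 0) = 0) ->
  forall z, D z -> nsq u v z = 0.
Proof.
move=> oD cD H Dx0 zero; apply: (hol_identity oD cD H Dx0).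
have [//|pz] := hol_zero_dichotomy oD H Dx0.
have nD : \forall w \near ((x0, 0) : plane), D w by exact: open_nbhs_nbhs.
have [r r0 Hr] := nbhs_ball_sub (filterI pz nD).
have [] := Hr (x0 + r / 2, 0).
  apply/plane_ballE; rewrite /= subrr normr0; split => //.
  by rewrite opprD addNKr normrN gtr0_norm ?divr_gt0//; lra.
move=> nzr /zero zr; exfalso; apply: nzr zr.
by move=> [] /eqP; rewrite -subr_eq0 addrAC subrr add0r mulf_eq0 gt_eqF//= invr_eq0 pnatr_eq0.
Qed.

(* Hurwitz: a zero that is isolated in the family at [q0] persists nearby, since
   otherwise 1/g would violate the maximum principle on a small circle. *)
Lemma hol_zero_persists (Q : topologicalType) (q0 : Q) D
    (u v : Q -> plane -> R) z0 : open D ->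
  (forall q, exists a b, hol D (u q) (v q) a b) -> D z0 ->
  (forall z, D z -> {for (z, q0), continuous (fun y : plane * Q => nsq (u y.2) (v y.2) y.1)}) ->
  nsq (u q0) (v q0) z0 = 0 ->
  (\forall z \near z0, z <> z0 -> nsq (u q0) (v q0) z <> 0) ->
  \forall q \near q0, exists2 z, D z & nsq (u q) (v q) z = 0.
Proof.
move=> oD H Dz0 cN N0 pz.
have nD : \forall w \near z0, D w by exact: open_nbhs_nbhs.
have [r r0 Hr] := nbhs_ball_sub (filterI pz nD).
pose s := r / 2 / 2; have s0 : 0 < s by rewrite !divr_gt0.
have disc x t : `|x| < r / 2 -> ball z0 r (circle z0 x t).
  move=> xr; have -> : r = r / 2 + r / 2 by lra.
  by apply: circle_in_ball; [exact: ltW|apply: ballxx; rewrite divr_gt0].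
have discD x t : `|x| < r / 2 -> D (circle z0 x t).
  by move=> xr; have [] := Hr _ (disc x t xr).
have sr : 0 <= s < r / 2 by rewrite /s; apply/andP; split; lra.
have sr' : `|s| < r / 2 by rewrite gtr0_norm//; case/andP: sr.
have circ_neq t : circle z0 s t <> z0.
  move=> E; have e1 : s * cos t = 0.
    have := congr1 fst E; rewrite /circle /= => /eqP.
    by rewrite -subr_eq0 addrAC subrr add0r => /eqP.
  have e2 : s * sin t = 0.
    have := congr1 snd E; rewrite /circle /= => /eqP.
    by rewrite -subr_eq0 addrAC subrr add0r => /eqP.
  move/eqP: e1; rewrite mulf_eq0 (gt_eqF s0) => /eqP e1.
  move/eqP: e2; rewrite mulf_eq0 (gt_eqF s0) => /eqP e2.
  have := cos2Dsin2 t; rewrite e1 e2 expr0n /= addr0 => /eqP.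
  by rewrite eq_sym oner_eq0.
(* At [q0] the left side is 0 and the right side is positive; joint continuity and compactness of
   the parameter segment keep the inequality for nearby [q]. *)
have near_lt : \forall q \near q0, forall t, 0 <= t <= tau ->
    nsq (u q) (v q) z0 < nsq (u q) (v q) (circle z0 s t).
  apply: (@near_segment R Q 0 tau
    (fun t q => nsq (u q) (v q) z0 < nsq (u q) (v q) (circle z0 s t))).
  move=> t _.
  pose F (y : R * Q) := nsq (u y.2) (v y.2) (circle z0 s y.1) - nsq (u y.2) (v y.2) z0.
  have h1 : {for (t, q0), continuous (fun y : R * Q => y.1)} by exact: fst_continuous.
  have h2 : {for (t, q0), continuous (fun y : R * Q => y.2)} by exact: snd_continuous.
  have h3 : {for (t, q0), continuous (fun _ : R * Q => z0)} by exact: cst_continuous.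
  have h4 : {for (t, q0), continuous (fun _ : R * Q => s)} by exact: cst_continuous.
  have h5 := pair_continuous (circle_continuous h3 h4 h1) h2.
  have h6 := pair_continuous h3 h2.
  have h7 := comp_continuous h5 (cN (circle z0 s t) (discD s t sr')).
  have h8 := comp_continuous h6 (cN z0 Dz0).
  have cF : {for (t, q0), continuous F} by exact: (real_continuousB h7 h8).
  have F0 : 0 < F (t, q0).
    rewrite /F /= N0 subr0 lt_def nsq_ge0 andbT; apply/eqP.
    by have [h _] := Hr _ (disc s t sr'); apply: h.
  by apply: filterS (near_gt0 cF F0) => y; rewrite /F subr_gt0.
apply: filterS near_lt => q lt; apply: contrapT => nz.
have nz' z : D z -> u q z ^+ 2 + v q z ^+ 2 != 0.
  by move=> Dz; apply/eqP => z0'; apply: nz; exists z.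
have [a [b Hq]] := H q; have [A [B HI]] := hol_inv oD Hq nz'.
have [t t01] := hol_max_circle oD HI discD sr.
have nI z : D z -> nsq (fun z => u q z / (u q z ^+ 2 + v q z ^+ 2))
   (fun z => - v q z / (u q z ^+ 2 + v q z ^+ 2)) z = (nsq (u q) (v q) z)^-1.
  by move=> /nz' h; rewrite /nsq; field.
have Dc := discD s t sr'.
rewrite !nI// lef_pV2 ?posrE ?lt_def ?nz' ?nsq_ge0//.
by rewrite leNgt lt.
Qed.

End Identity.

(** * Octonions in coordinates *)

Section OctonionAlgebra.
Context {R : realType}.

Definition oct (x0 x1 x2 x3 x4 x5 x6 x7 : R) : octonion R :=
  (((x0, x1), (x2, x3)), ((x4, x5), (x6, x7))).

Let quat (x0 x1 x2 x3 : R) : quaternion R := ((x0, x1), (x2, x3)).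

Let quatD x0 x1 x2 x3 y0 y1 y2 y3 : quat x0 x1 x2 x3 + quat y0 y1 y2 y3 =
  quat (x0 + y0) (x1 + y1) (x2 + y2) (x3 + y3).
Proof. by []. Qed.

Let quatB x0 x1 x2 x3 y0 y1 y2 y3 : quat x0 x1 x2 x3 - quat y0 y1 y2 y3 =
  quat (x0 - y0) (x1 - y1) (x2 - y2) (x3 - y3).
Proof. by []. Qed.

Let qconjE x0 x1 x2 x3 : qconj (quat x0 x1 x2 x3) = quat x0 (- x1) (- x2) (- x3).
Proof. by []. Qed.

Let qmulE (a0 a1 a2 a3 b0 b1 b2 b3 : R) :
  qmul (quat a0 a1 a2 a3) (quat b0 b1 b2 b3) = quat
   (a0 * b0 - a1 * b1 - a2 * b2 - a3 * b3) (a0 * b1 + a1 * b0 + a2 * b3 - a3 * b2)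
   (a0 * b2 - a1 * b3 + a2 * b0 + a3 * b1) (a0 * b3 + a1 * b2 - a2 * b1 + a3 * b0).
Proof.
transitivity (quat
  (a0 * b0 - b1 * a1 - (b2 * a2 - a3 * - b3)) (b1 * a0 + a1 * b0 - (a3 * b2 + - b3 * a2))
  (b2 * a0 - a1 * b3 + (a2 * b0 - - b1 * a3)) (a1 * b2 + b3 * a0 + (- b1 * a2 + a3 * b0))).
  by [].
congr quat; ring.
Qed.

(** With the product written as eight polynomials, the octonion identities below are polynomial
    identities left to [ring]. *)
Lemma omulE (a0 a1 a2 a3 a4 a5 a6 a7 b0 b1 b2 b3 b4 b5 b6 b7 : R) :
  omul (oct a0 a1 a2 a3 a4 a5 a6 a7) (oct b0 b1 b2 b3 b4 b5 b6 b7) = oct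
   (a0 * b0 - a1 * b1 - a2 * b2 - a3 * b3 - a4 * b4 - a5 * b5 - a6 * b6 - a7 * b7)
   (a0 * b1 + a1 * b0 + a2 * b3 - a3 * b2 + a4 * b5 - a5 * b4 - a6 * b7 + a7 * b6)
   (a0 * b2 - a1 * b3 + a2 * b0 + a3 * b1 + a4 * b6 + a5 * b7 - a6 * b4 - a7 * b5)
   (a0 * b3 + a1 * b2 - a2 * b1 + a3 * b0 + a4 * b7 - a5 * b6 + a6 * b5 - a7 * b4)
   (a0 * b4 - a1 * b5 - a2 * b6 - a3 * b7 + a4 * b0 + a5 * b1 + a6 * b2 + a7 * b3)
   (a0 * b5 + a1 * b4 - a2 * b7 + a3 * b6 - a4 * b1 + a5 * b0 - a6 * b3 + a7 * b2)
   (a0 * b6 + a1 * b7 + a2 * b4 - a3 * b5 - a4 * b2 + a5 * b3 + a6 * b0 - a7 * b1)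
   (a0 * b7 - a1 * b6 + a2 * b5 + a3 * b4 - a4 * b3 - a5 * b2 + a6 * b1 + a7 * b0).
Proof.
transitivity (
  (qmul (quat a0 a1 a2 a3) (quat b0 b1 b2 b3) -
     qmul (qconj (quat b4 b5 b6 b7)) (quat a4 a5 a6 a7),
   qmul (quat b4 b5 b6 b7) (quat a0 a1 a2 a3) +
     qmul (quat a4 a5 a6 a7) (qconj (quat b0 b1 b2 b3)))); first by [].
rewrite !qconjE !qmulE quatB quatD.
transitivity (oct
  (a0 * b0 - a1 * b1 - a2 * b2 - a3 * b3 - (b4 * a4 - - b5 * a5 - - b6 * a6 - - b7 * a7))
  (a0 * b1 + a1 * b0 + a2 * b3 - a3 * b2 - (b4 * a5 + - b5 * a4 + - b6 * a7 - - b7 * a6))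
  (a0 * b2 - a1 * b3 + a2 * b0 + a3 * b1 - (b4 * a6 - - b5 * a7 + - b6 * a4 + - b7 * a5))
  (a0 * b3 + a1 * b2 - a2 * b1 + a3 * b0 - (b4 * a7 + - b5 * a6 - - b6 * a5 + - b7 * a4))
  (b4 * a0 - b5 * a1 - b6 * a2 - b7 * a3 + (a4 * b0 - a5 * - b1 - a6 * - b2 - a7 * - b3))
  (b4 * a1 + b5 * a0 + b6 * a3 - b7 * a2 + (a4 * - b1 + a5 * b0 + a6 * - b3 - a7 * - b2))
  (b4 * a2 - b5 * a3 + b6 * a0 + b7 * a1 + (a4 * - b2 - a5 * - b3 + a6 * b0 + a7 * - b1))
  (b4 * a3 + b5 * a2 - b6 * a1 + b7 * a0 + (a4 * - b3 + a5 * - b2 - a6 * - b1 + a7 * b0))).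
  by [].
congr oct; ring.
Qed.

Implicit Types (w a b q I J : octonion R) (k j : 'I_8).

(** Indexing by ['I_8] lets holomorphy be treated in all coordinates at once; the default 0 of [nth]
    is never reached. *)
Definition ocoord (k : 'I_8) w : R := nth 0 [:: w.1.1.1 : R; w.1.1.2 : R;
  w.1.2.1 : R; w.1.2.2 : R; w.2.1.1 : R; w.2.1.2 : R; w.2.2.1 : R; w.2.2.2 : R] k.

Lemma octP (P : octonion R -> Prop) :
  (forall x0 x1 x2 x3 x4 x5 x6 x7, P (oct x0 x1 x2 x3 x4 x5 x6 x7)) -> forall w, P w.
Proof. by move=> H [[[? ?] [? ?]] [[? ?] [? ?]]]; exact: H. Qed.

Lemma ord8P (P : 'I_8 -> Prop) : P (@Ordinal 8 0 isT) -> P (@Ordinal 8 1 isT) ->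
  P (@Ordinal 8 2 isT) -> P (@Ordinal 8 3 isT) -> P (@Ordinal 8 4 isT) ->
  P (@Ordinal 8 5 isT) -> P (@Ordinal 8 6 isT) -> P (@Ordinal 8 7 isT) ->
  forall k, P k.
Proof.
by move=> ? ? ? ? ? ? ? ? [[|[|[|[|[|[|[|[|k]]]]]]]] i] //; rewrite (bool_irrelevance i isT).
Qed.

Lemma sum8 (F : 'I_8 -> R) : \sum_k F k =
  F (@Ordinal 8 0 isT) + F (@Ordinal 8 1 isT) + F (@Ordinal 8 2 isT) +
  F (@Ordinal 8 3 isT) + F (@Ordinal 8 4 isT) + F (@Ordinal 8 5 isT) +
  F (@Ordinal 8 6 isT) + F (@Ordinal 8 7 isT).
Proof.
rewrite !big_ord_recr big_ord0 /= add0r.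
by do ! congr (_ + _); congr F; apply: val_inj.
Qed.

Lemma ocoord_inj a b : (forall k, ocoord k a = ocoord k b) -> a = b.
Proof.
elim/octP: a => a0 a1 a2 a3 a4 a5 a6 a7; elim/octP: b => b0 b1 b2 b3 b4 b5 b6 b7 E.
by congr oct; [have := E (@Ordinal 8 0 isT)|have := E (@Ordinal 8 1 isT)|
 have := E (@Ordinal 8 2 isT)|have := E (@Ordinal 8 3 isT)|have := E (@Ordinal 8 4 isT)|
 have := E (@Ordinal 8 5 isT)|have := E (@Ordinal 8 6 isT)|have := E (@Ordinal 8 7 isT)].
Qed.

Lemma ocoordD k a b : ocoord k (a + b) = ocoord k a + ocoord k b.
Proof. by elim/ord8P: k. Qed.

Lemma ocoordB k a b : ocoord k (a - b) = ocoord k a - ocoord k b.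
Proof. by elim/ord8P: k. Qed.

Lemma ocoordN k a : ocoord k (- a) = - ocoord k a.
Proof. by elim/ord8P: k. Qed.

Lemma ocoord0 k : ocoord k 0 = 0.
Proof. by elim/ord8P: k. Qed.

Definition obasis (j : 'I_8) : octonion R := oct (j == 0 :> nat)%:R (j == 1 :> nat)%:R
  (j == 2 :> nat)%:R (j == 3 :> nat)%:R (j == 4 :> nat)%:R (j == 5 :> nat)%:R
  (j == 6 :> nat)%:R (j == 7 :> nat)%:R.

(** Left multiplication by [J] as a real 8 x 8 matrix: derivatives and holomorphy pass from the
    coordinates of [w] to those of [omul J w]. *)
Lemma ocoord_omul k J w :
  ocoord k (omul J w) = \sum_j ocoord k (omul J (obasis j)) * ocoord j w.
Proof.
elim/octP: J => a0 a1 a2 a3 a4 a5 a6 a7; elim/octP: w => b0 b1 b2 b3 b4 b5 b6 b7.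
rewrite sum8 /obasis !omulE.
by elim/ord8P: k; rewrite /ocoord /oct /=; ring.
Qed.

Definition odot a b : R := \sum_k ocoord k a * ocoord k b.

(** The imaginary coordinates of the square are 2 a0 ak. If a0 were nonzero, all other coordinates
    would vanish and a0^2 = -1, which is impossible over the reals. *)
Lemma imaginary_unitsP J : imaginary_units J <->
  ocoord ord0 J = 0 /\ odot J J = 1.
Proof.
rewrite /odot sum8.
elim/octP: J => a0 a1 a2 a3 a4 a5 a6 a7; rewrite /imaginary_units /= omulE.
have -> : oreal (- 1) = oct (- 1) 0 0 0 0 0 0 0 :> octonion R by [].
rewrite /ocoord /oct /=; split.
  case=> e0 e1 e2 e3 e4 e5 e6 e7.
  have [z|nz] := eqVneq a0 0.
    by split => //; move: e0; rewrite z; lra.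
  have c (x y : R) : y = a0 * x *+ 2 -> y = 0 -> x = 0.
    by move=> -> /eqP; rewrite mulrn_eq0 /= mulf_eq0 (negbTE nz) => /eqP.
  have b1 : a1 = 0 by apply: c e1; ring.
  have b2 : a2 = 0 by apply: c e2; ring.
  have b3 : a3 = 0 by apply: c e3; ring.
  have b4 : a4 = 0 by apply: c e4; ring.
  have b5 : a5 = 0 by apply: c e5; ring.
  have b6 : a6 = 0 by apply: c e6; ring.
  have b7 : a7 = 0 by apply: c e7; ring.
  move: e0; rewrite b1 b2 b3 b4 b5 b6 b7 !mul0r !subr0 => e0.
  have := sqr_ge0 a0; rewrite expr2; lra.
case=> -> n1; congr oct; try ring.
by rewrite -n1; ring.
Qed.

(** Left alternativity J (J w) = (J J) w; it makes left multiplication by [J] a complex structure on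
    the octonions. *)
Lemma omul_unitK J w : imaginary_units J -> omul J (omul J w) = - w.
Proof.
move=> /imaginary_unitsP[]; rewrite /odot sum8.
elim/octP: J => a0 a1 a2 a3 a4 a5 a6 a7; elim/octP: w => b0 b1 b2 b3 b4 b5 b6 b7.
rewrite /ocoord /oct /= => -> n1; rewrite -!/(oct _ _ _ _ _ _ _ _) !omulE.
(* The factors [- 1] are made explicit so that [n1] can replace 1 by the squared norm of [J],
   leaving polynomial identities. *)
have -> : - oct b0 b1 b2 b3 b4 b5 b6 b7 = oct (- 1 * b0) (- 1 * b1) (- 1 * b2)
  (- 1 * b3) (- 1 * b4) (- 1 * b5) (- 1 * b6) (- 1 * b7).
  by rewrite !mulN1r.
rewrite -n1; congr oct; ring.
Qed.

Lemma slice_pointE J (x y : R) k :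
  ocoord k (slice_point J (x, y)) = (k == ord0)%:R * x + y * ocoord k J.
Proof.
rewrite /slice_point ocoordD.
have -> : oreal (x, y).1 = oct x 0 0 0 0 0 0 0 by [].
have -> : oreal (x, y).2 = oct y 0 0 0 0 0 0 0 by [].
elim/octP: J => a0 a1 a2 a3 a4 a5 a6 a7; rewrite omulE.
by elim/ord8P: k; rewrite /ocoord /oct /=; ring.
Qed.

Lemma unit_orthogonal J a b : imaginary_units J -> a + omul J b = 0 ->
  odot a a = odot b b /\ odot a b = 0.
Proof.
move=> /imaginary_unitsP[]; rewrite /odot !sum8.
elim/octP: J => j0 j1 j2 j3 j4 j5 j6 j7; elim/octP: b => b0 b1 b2 b3 b4 b5 b6 b7.
rewrite omulE => j00 n1 /eqP; rewrite addr_eq0 => /eqP ->.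
move: j00 n1; rewrite /ocoord /oct /= => -> n1.
split; last by ring.
by rewrite -[RHS]mul1r -n1; ring.
Qed.

Lemma exists_imaginary_unit : exists J : octonion R, imaginary_units J.
Proof.
exists (oct 0 1 0 0 0 0 0 0); apply/imaginary_unitsP; rewrite /odot sum8.
by rewrite /ocoord /oct /=; split => //; ring.
Qed.

Lemma odot_eq0 b : odot b b = 0 -> b = 0.
Proof.
move=> /eqP; rewrite psumr_eq0; last by move=> k _; rewrite -expr2 sqr_ge0.
move=> /allP b0; apply: ocoord_inj => k; rewrite ocoord0.
by have := b0 k; rewrite mem_index_enum -expr2 sqrf_eq0 => /(_ isT)/eqP.
Qed.

(* If b <> 0 the unit is - (a conj b) / |b|^2. *)
Lemma orthogonal_unit a b : odot a a = odot b b -> odot a b = 0 ->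
  exists2 J, imaginary_units J & a + omul J b = 0.
Proof.
move=> ab ab0; have [b0|bn0] := eqVneq (odot b b) 0.
  have [J JU] := exists_imaginary_unit; exists J => //.
  rewrite (odot_eq0 b0) (odot_eq0 (etrans ab b0)) add0r.
  apply: ocoord_inj => k; rewrite ocoord_omul ocoord0 big1// => j _.
  by rewrite ocoord0 mulr0.
move: ab ab0 bn0; rewrite /odot !sum8.
elim/octP: a => a0 a1 a2 a3 a4 a5 a6 a7; elim/octP: b => b0 b1 b2 b3 b4 b5 b6 b7.
rewrite /ocoord /oct /=; set n := (X in X != 0) => ab ab0 bn0.
pose m := - n^-1.
have mn : m * n = - 1 by rewrite /m mulNr mulVf.
(* [e0], ..., [e7] are the coordinates of a conj(b); [e0] is the inner product of a and b, so the
   unit has no real part. *)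
pose e0 := a0 * b0 + a1 * b1 + a2 * b2 + a3 * b3 + a4 * b4 + a5 * b5 + a6 * b6 + a7 * b7.
pose e1 := - a0 * b1 + a1 * b0 - a2 * b3 + a3 * b2 - a4 * b5 + a5 * b4 + a6 * b7 - a7 * b6.
pose e2 := - a0 * b2 + a1 * b3 + a2 * b0 - a3 * b1 - a4 * b6 - a5 * b7 + a6 * b4 + a7 * b5.
pose e3 := - a0 * b3 - a1 * b2 + a2 * b1 + a3 * b0 - a4 * b7 + a5 * b6 - a6 * b5 + a7 * b4.
pose e4 := - a0 * b4 + a1 * b5 + a2 * b6 + a3 * b7 + a4 * b0 - a5 * b1 - a6 * b2 - a7 * b3.
pose e5 := - a0 * b5 - a1 * b4 + a2 * b7 - a3 * b6 + a4 * b1 + a5 * b0 + a6 * b3 - a7 * b2.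
pose e6 := - a0 * b6 - a1 * b7 - a2 * b4 + a3 * b5 + a4 * b2 - a5 * b3 + a6 * b0 + a7 * b1.
pose e7 := - a0 * b7 + a1 * b6 - a2 * b5 - a3 * b4 + a4 * b3 + a5 * b2 - a6 * b1 + a7 * b0.
exists (oct (m * e0) (m * e1) (m * e2) (m * e3) (m * e4) (m * e5) (m * e6) (m * e7)).
  apply/imaginary_unitsP; rewrite /odot sum8 /ocoord /oct /=.
  split; first by rewrite /e0 ab0 mulr0.
  (* The eight-square identity |a conj(b)|^2 = |a|^2 |b|^2. *)
  transitivity (m ^+ 2 * ((a0 * a0 + a1 * a1 + a2 * a2 + a3 * a3 + a4 * a4 + a5 * a5 +
    a6 * a6 + a7 * a7) * n)).
    by rewrite /n /e0 /e1 /e2 /e3 /e4 /e5 /e6 /e7; ring.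
  by rewrite ab -/n -expr2 -exprMn mn sqrrN expr1n.
rewrite -!/(oct _ _ _ _ _ _ _ _) omulE.
apply/eqP; rewrite addrC addr_eq0; apply/eqP.
have -> : - oct a0 a1 a2 a3 a4 a5 a6 a7 = oct (- 1 * a0) (- 1 * a1) (- 1 * a2)
  (- 1 * a3) (- 1 * a4) (- 1 * a5) (- 1 * a6) (- 1 * a7).
  by rewrite !mulN1r.
rewrite -mn; congr oct; rewrite /n /e0 /e1 /e2 /e3 /e4 /e5 /e6 /e7; ring.
Qed.

End OctonionAlgebra.

(** * The stem function *)

Section Slices.
Context {R : realType}.
Local Notation plane := (R^o * R^o)%type.
Local Notation O := (octonion R).
Implicit Types (D : set plane) (p z w e : plane) (u v a b : plane -> R).
Implicit Types (G : plane -> O) (q I J : O) (k j : 'I_8).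

Lemma real_continuous_sum (T : topologicalType) (F : 'I_8 -> T -> R) (x : T) :
  (forall k, {for x, continuous (F k)}) ->
  {for x, continuous (fun y => \sum_k F k y)}.
Proof.
move=> cF.
have -> : (fun y => \sum_k F k y) = (fun y =>
  F (@Ordinal 8 0 isT) y + F (@Ordinal 8 1 isT) y + F (@Ordinal 8 2 isT) y +
  F (@Ordinal 8 3 isT) y + F (@Ordinal 8 4 isT) y + F (@Ordinal 8 5 isT) y +
  F (@Ordinal 8 6 isT) y + F (@Ordinal 8 7 isT) y).
  by apply/funext => y; rewrite sum8.
by do 7! (apply: real_continuousD; last exact: cF); exact: cF.
Qed.

Lemma is_derive_bigsum (F : 'I_8 -> plane -> R) (d : 'I_8 -> R) p e :
  (forall k, is_derive p e (F k) (d k)) ->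
  is_derive p e (fun z => \sum_k F k z) (\sum_k d k).
Proof.
move=> dF.
have -> : (fun z => \sum_k F k z) = \sum_k F k.
  by apply/funext => z; rewrite fct_sumE.
exact: is_derive_sum.
Qed.

Lemma hol_scale D (c : R) u v a b : hol D u v a b ->
  hol D (fun z => c * u z) (fun z => c * v z) (fun z => c * a z) (fun z => c * b z).
Proof.
move=> H p Dp; have [ux uy vx vy [ca cb]] := H _ Dp.
split.
- exact: (is_deriveZ c ux).
- by rewrite -mulrN; exact: (is_deriveZ c uy).
- exact: (is_deriveZ c vx).
- exact: (is_deriveZ c vy).
- have cc := @real_continuous_cst _ _ c p.
  by split; [exact: (real_continuousM cc ca)|exact: (real_continuousM cc cb)].
Qed.

Lemma hol_bigsum D (U V : 'I_8 -> plane -> R) :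
  (forall k, exists a b, hol D (U k) (V k) a b) ->
  exists a b, hol D (fun z => \sum_k U k z) (fun z => \sum_k V k z) a b.
Proof.
move=> /choice[A] /choice[B] H.
exists (fun z => \sum_k A k z), (fun z => \sum_k B k z) => p Dp.
have HD k := H k p Dp.
split.
- by apply: is_derive_bigsum => k; have [] := HD k.
- rewrite -sumrN.
  by apply: (@is_derive_bigsum _ (fun k => - B k p)) => k; have [] := HD k.
- by apply: is_derive_bigsum => k; have [] := HD k.
- by apply: is_derive_bigsum => k; have [] := HD k.
- by split; apply: real_continuous_sum => k; have [_ _ _ _ []] := HD k.
Qed.

(** The projections are linear and continuous, hence pass through the limit of difference quotients;
    three applications reach the real coordinates. *)
Lemma is_derive_pair (V W1 W2 : normedModType R) (G : V -> (W1 * W2)%type) (p e : V) d :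
  is_derive p e G d ->
  is_derive p e (fun y => (G y).1) d.1 /\ is_derive p e (fun y => (G y).2) d.2.
Proof.
move=> [dG <-].
have cG : (fun h => h^-1 *: ((G \o shift p) (h *: e) - G p)) @ 0^' --> 'D_e G p.
  exact: dG.
have c1 : (fun h => h^-1 *: (((fun y => (G y).1) \o shift p) (h *: e) - (G p).1)) @ 0^'
    --> ('D_e G p).1.
  by move=> A nA; exact: (cG _ (@fst_continuous W1 W2 _ _ nA)).
have c2 : (fun h => h^-1 *: (((fun y => (G y).2) \o shift p) (h *: e) - (G p).2)) @ 0^'
    --> ('D_e G p).2.
  by move=> A nA; exact: (cG _ (@snd_continuous W1 W2 _ _ nA)).
by split; split; [apply/cvg_ex; eexists; exact: c1|exact: cvg_lim c1|
  apply/cvg_ex; eexists; exact: c2|exact: cvg_lim c2].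
Qed.

Lemma is_derive_ocoord G p e (d : O) k : is_derive p e G d ->
  is_derive p e (fun z => ocoord k (G z)) (ocoord k d).
Proof.
move=> /is_derive_pair[/is_derive_pair[/is_derive_pair[d0 d1] /is_derive_pair[d2 d3]]
  /is_derive_pair[/is_derive_pair[d4 d5] /is_derive_pair[d6 d7]]].
by elim/ord8P: k.
Qed.

Lemma ocoord_continuous k : continuous (ocoord k : O -> R).
Proof.
move=> w.
have f (X Y Z : topologicalType) (h : X -> (Y * Z)%type) (x : X) :
    {for x, continuous h} -> {for x, continuous (fun y => (h y).1)} /\
    {for x, continuous (fun y => (h y).2)}.
  by move=> ch; split; apply: (comp_continuous ch); [exact: fst_continuous|exact: snd_continuous].
have c0 : {for w, continuous (fun w : O => w)} by exact: cvg_id.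
have [c1 c2] := f _ (quaternion R) (quaternion R) _ _ c0.
have [c11 c12] := f _ (cplx R) (cplx R) _ _ c1.
have [c21 c22] := f _ (cplx R) (cplx R) _ _ c2.
have [c111 c112] := f _ R^o R^o _ _ c11.
have [c121 c122] := f _ R^o R^o _ _ c12.
have [c211 c212] := f _ R^o R^o _ _ c21.
have [c221 c222] := f _ R^o R^o _ _ c22.
by elim/ord8P: k.
Qed.

End Slices.

(** * Slices as holomorphic functions; polar form of an octonion *)

Section Representation.
Context {R : realType}.
Local Notation plane := (R^o * R^o)%type.
Local Notation dx := (dir_x R).
Local Notation dy := (dir_y R).
Local Notation O := (octonion R).
Implicit Types (D : set plane) (p z w : plane) (u v a b : plane -> R).
Implicit Types (q I J : O) (k j : 'I_8).

Lemma omulN J (w : O) : omul J (- w) = - omul J w.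
Proof.
apply: ocoord_inj => k; rewrite ocoordN !(ocoord_omul k J) -sumrN.
by apply: eq_bigr => j _; rewrite ocoordN mulrN.
Qed.

Lemma omul_unit_inj J (x y : O) : imaginary_units J -> omul J y = - x -> omul J x = y.
Proof.
move=> JU E; have -> : x = - omul J y by rewrite E opprK.
by rewrite omulN omul_unitK// opprK.
Qed.

(** The map w |-> w_k - i (J w)_k is complex linear when i acts on the octonions as left
    multiplication by J. Slice regularity says F_y = J F_x, so composing F with this map gives a
    holomorphic function. *)
Lemma hol_slice (Omega : set O) (f : O -> O) J k :
  slice_regular Omega f -> imaginary_units J -> open (slice_set J Omega) ->
  exists a b, hol (slice_set J Omega) (fun z => ocoord k (slice_fun J f z))
    (fun z => - ocoord k (omul J (slice_fun J f z))) a b.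
Proof.
move=> sf JU oD; have [dF cx cy CR] := sf J JU.
set D := slice_set J Omega in oD dF cx cy CR *.
set F := slice_fun J f in dF cx cy CR *.
have CR1 z : D z -> omul J ('D_dy F z) = - 'D_dx F z.
  move=> /CR /eqP; rewrite scaler_eq0 invr_eq0 pnatr_eq0 /= addrC addr_eq0.
  by move=> /eqP.
have CR2 z : D z -> omul J ('D_dx F z) = 'D_dy F z.
  by move=> /CR1; exact: omul_unit_inj.
have cont (H : plane -> O) z : {within D, continuous H} -> D z ->
    {for z, continuous (fun z => ocoord k (H z))}.
  rewrite continuous_open_subspace// => cH Dz.
  have cHz : {for z, continuous H} by apply: cH; rewrite inE.
  exact: (comp_continuous cHz (@ocoord_continuous R k _)).
exists (fun z => ocoord k ('D_dx F z)), (fun z => - ocoord k ('D_dy F z)) => z Dz.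
have [Fx Fy] := dF z Dz.
have dFx := is_derive_ocoord _ (derivableP Fx).
have dFy := is_derive_ocoord _ (derivableP Fy).
have V e (d : O) : (forall j, is_derive z e (fun z => ocoord j (F z)) (ocoord j d)) ->
    is_derive z e (fun z => - ocoord k (omul J (F z))) (- ocoord k (omul J d)).
  move=> dF'.
  have -> : (fun z => - ocoord k (omul J (F z))) =
      - (fun z => \sum_j ocoord k (omul J (obasis j)) * ocoord j (F z)).
    by apply/funext => y; rewrite ocoord_omul.
  have h j : is_derive z e (fun z => ocoord k (omul J (obasis j)) * ocoord j (F z))
      (ocoord k (omul J (obasis j)) * ocoord j d).
    exact: (is_deriveZ _ (dF' j)).
  by rewrite ocoord_omul; exact: (is_deriveN (is_derive_bigsum h)).
split.
- exact: dFx.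
- by rewrite opprK; exact: dFy.
- by have := V _ _ dFx; rewrite CR2.
- by have := V _ _ dFy; rewrite CR1// ocoordN opprK.
- by split; [exact: (cont _ _ cx Dz)|exact: (real_continuousN (cont _ _ cy Dz))].
Qed.

Definition omk (c : 'I_8 -> R) : O := oct (c (@Ordinal 8 0 isT)) (c (@Ordinal 8 1 isT))
  (c (@Ordinal 8 2 isT)) (c (@Ordinal 8 3 isT)) (c (@Ordinal 8 4 isT))
  (c (@Ordinal 8 5 isT)) (c (@Ordinal 8 6 isT)) (c (@Ordinal 8 7 isT)).

Lemma ocoord_omk c k : ocoord k (omk c) = c k.
Proof. by elim/ord8P: k. Qed.

Lemma imaginary_unitN J : imaginary_units J -> imaginary_units (- J).
Proof.
move=> /imaginary_unitsP[J0 J1]; apply/imaginary_unitsP.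
rewrite ocoordN J0 oppr0; split => //; rewrite -J1.
by apply: eq_bigr => k _; rewrite !ocoordN mulrNN.
Qed.

Lemma slice_pointN J (x y : R) : slice_point (- J) (x, y) = slice_point J (x, - y).
Proof. by apply: ocoord_inj => k; rewrite !slice_pointE ocoordN mulrN mulNr. Qed.

Lemma slice_point_real J (x : R) : slice_point J (x, 0) = oreal x.
Proof.
apply: ocoord_inj => k; rewrite slice_pointE mul0r addr0.
by elim/ord8P: k; rewrite /ocoord /= ?mul1r ?mul0r.
Qed.

(** [J] is the imaginary part of [w] divided by its norm; for real [w] any unit serves. *)
Lemma slice_pointP (w : O) :
  exists J (x y : R), imaginary_units J /\ w = slice_point J (x, y).
Proof.
elim/(@octP R): w => w0 w1 w2 w3 w4 w5 w6 w7.
set n := w1 ^+ 2 + w2 ^+ 2 + w3 ^+ 2 + w4 ^+ 2 + w5 ^+ 2 + w6 ^+ 2 + w7 ^+ 2.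
have n0 : 0 <= n by rewrite /n !addr_ge0 ?sqr_ge0.
have [ez|nz] := eqVneq n 0.
  have [J JU] := @exists_imaginary_unit R.
  exists J, w0, 0; split => //; rewrite slice_point_real.
  move/eqP: ez; rewrite /n !paddr_eq0 ?addr_ge0 ?sqr_ge0// !sqrf_eq0.
  move=> /andP[/andP[/andP[/andP[/andP[/andP[]]]]]].
  by do 7 ! move=> /eqP->.
pose y := Num.sqrt n.
have y0 : y != 0 by rewrite sqrtr_eq0 -ltNge lt_def nz n0.
have yy : y ^+ 2 = n by exact: sqr_sqrtr.
exists (oct 0 (w1 / y) (w2 / y) (w3 / y) (w4 / y) (w5 / y) (w6 / y) (w7 / y)), w0, y.
split.
  apply/imaginary_unitsP; rewrite /odot sum8 /ocoord /oct /=; split => //.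
  transitivity (n / y ^+ 2); last by rewrite yy divff.
  by rewrite /n; field.
apply: ocoord_inj => k; rewrite slice_pointE.
by elim/ord8P: k; rewrite /ocoord /oct /=; field.
Qed.

Lemma slice_point_continuous J : continuous (slice_point J : plane -> O).
Proof.
move=> z.
have c k : {for z, continuous (fun z : plane => (k == ord0)%:R * z.1 + z.2 * ocoord k J)}.
  have h1 : {for z, continuous (fun z : plane => z.1 : R)} by exact: plane_fst_continuous.
  have h2 : {for z, continuous (fun z : plane => z.2 : R)} by exact: plane_snd_continuous.
  have c1 := @real_continuous_cst _ _ ((k == ord0)%:R : R) z.
  have c2 := @real_continuous_cst _ _ (ocoord k J) z.
  exact: (real_continuousD (real_continuousM c1 h1) (real_continuousM h2 c2)).
have -> : slice_point J = (fun z => omk (fun k => (k == ord0)%:R * z.1 + z.2 * ocoord k J)).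
  apply/funext => -[x y]; apply: ocoord_inj => k.
  by rewrite ocoord_omk slice_pointE.
have P (X Y : topologicalType) (h1 : plane -> X) (h2 : plane -> Y) :
  {for z, continuous h1} -> {for z, continuous h2} ->
  {for z, continuous (fun z => (h1 z, h2 z))} by exact: pair_continuous.
have q1 := P R^o R^o _ _ (c (@Ordinal 8 0 isT)) (c (@Ordinal 8 1 isT)).
have q2 := P R^o R^o _ _ (c (@Ordinal 8 2 isT)) (c (@Ordinal 8 3 isT)).
have q3 := P R^o R^o _ _ (c (@Ordinal 8 4 isT)) (c (@Ordinal 8 5 isT)).
have q4 := P R^o R^o _ _ (c (@Ordinal 8 6 isT)) (c (@Ordinal 8 7 isT)).
exact: (P _ _ _ _ (P _ _ _ _ q1 q2) (P _ _ _ _ q3 q4)).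
Qed.

Lemma open_slice_set J (U : set O) : open U -> open (slice_set J U).
Proof.
by move=> oU; apply: (open_comp _ oU) => z _; exact: slice_point_continuous.
Qed.

Lemma slice_set_indep (U : set O) I J : axially_symmetric U ->
  imaginary_units I -> imaginary_units J -> slice_set I U `<=` slice_set J U.
Proof. by move=> sU IU JU [x y]; exact: sU. Qed.

End Representation.

(** * The representation formula and open images *)

Section OpenMapping.
Context {R : realType}.
Local Notation plane := (R^o * R^o)%type.
Local Notation O := (octonion R).
Implicit Types (D : set plane) (p z w : plane) (u v a b : plane -> R).
Implicit Types (q I J : O) (k j : 'I_8).

Lemma nsq_eq0 u v z : nsq u v z = 0 <-> u z = 0 /\ v z = 0.
Proof.
split=> [/eqP|[uz vz]]; last by rewrite /nsq uz vz expr0n addr0.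
by rewrite /nsq paddr_eq0 ?sqr_ge0// !sqrf_eq0 => /andP[/eqP ? /eqP ?].
Qed.

Definition reflect_y z : plane := (z.1, - z.2).

(* Components of the stem function alpha + i beta, with
   alpha = (f_I(z) + f_I(conj z)) / 2 and beta = - I (f_I(z) - f_I(conj z)) / 2. *)
Definition stem_re I (f : O -> O) k z : R :=
  2^-1 * (ocoord k (slice_fun I f z) + ocoord k (slice_fun I f (reflect_y z))).

Definition stem_im I (f : O -> O) k z : R :=
  2^-1 * (- ocoord k (omul I (slice_fun I f z)) +
            ocoord k (omul I (slice_fun I f (reflect_y z)))).

Variables (Omega : set O) (f : O -> O) (I : O).
Hypotheses (ssd : symmetric_slice_domain Omega) (sr : slice_regular Omega f).
Hypothesis IU : imaginary_units I.

Local Notation D := (slice_set I Omega).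
Local Notation alpha := (stem_re I f).
Local Notation beta := (stem_im I f).

Let oD : open D. Proof. by have [_ _ _ /(_ I IU)[]] := ssd. Qed.

Let cD : connected D. Proof. by have [_ _ _ /(_ I IU)[]] := ssd. Qed.

Let sO : axially_symmetric Omega. Proof. by have [_ ? _ _] := ssd. Qed.

Let real_point : exists x : R, D (x, 0).
Proof.
have [_ _ [x Ox] _] := ssd; exists x.
by rewrite /slice_set /= slice_point_real.
Qed.

(** The conjugate of a point of C_I has the same coordinates with respect to -I as the point has
    with respect to I, so axial symmetry applies. *)
Let reflectD z : D z -> D (reflect_y z).
Proof.
case: z => x y Dz; rewrite /slice_set /reflect_y /= -slice_pointN.
by apply: (sO IU) => //; exact: imaginary_unitN.
Qed.

(** For g the function of [hol_slice], the component is (g(z) + conj(g(conj z))) / 2, and the second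
    summand is the case [s = -1] of [hol_affine]. *)
Lemma hol_stem k : exists a b, hol D (alpha k) (beta k) a b.
Proof.
have [a [b H]] := hol_slice k sr IU oD.
have H2 := @hol_affine R D D _ _ a b 1 (-1) 0 oD (or_intror erefl) H.
have E z : (0 + 1 * z.1, 0 + -1 * 1 * z.2) = reflect_y z :> plane.
  by rewrite /reflect_y !add0r !mul1r mulr1 mulN1r.
have {}H2 := H2 _.
have DD z : D z -> D ((0 : plane).1 + 1 * z.1, (0 : plane).2 + -1 * 1 * z.2).
  by rewrite E; exact: reflectD.
have := hol_scale 2^-1 (hol_add H (H2 DD)).
move=> /(hol_eq oD) H3; eexists; eexists; apply: H3 => z _.
  by rewrite /stem_re E.
by rewrite /stem_im E mulN1r opprK.
Qed.

Lemma stem_real k (x : R) :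
  alpha k (x, 0) = ocoord k (f (oreal x)) /\ beta k (x, 0) = 0.
Proof.
rewrite /stem_re /stem_im /reflect_y /slice_fun /= oppr0 slice_point_real.
by split; [field|rewrite addNr mulr0].
Qed.

(** Both sides are holomorphic for the complex structure J, and on the real axis beta vanishes and
    alpha is f, so they agree there. The identity principle is applied to one coordinate at a
    time. *)
Lemma representation J z : imaginary_units J -> D z ->
  slice_fun J f z = omk (alpha ^~ z) + omul J (omk (beta ^~ z)).
Proof.
move=> JU Dz; apply: ocoord_inj => k.
have DJ : D = slice_set J Omega.
  by apply/seteqP; split; exact: slice_set_indep.
have oDJ : open (slice_set J Omega) by rewrite -DJ.
have [a [b HJ]] := hol_slice k sr JU oDJ; rewrite -DJ in HJ.
have [a1 [b1 Hk]] := hol_stem k.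
pose M j := ocoord k (omul J (obasis j)).
have [a2 [b2 Hs]] : exists a b, hol D (fun z => \sum_j M j * - beta j z)
    (fun z => \sum_j M j * alpha j z) a b.
  apply: hol_bigsum => j; have [c [d Hj]] := hol_stem j.
  do 2 eexists.
  apply: (hol_eq oD _ _ (hol_scale (- M j) (hol_rot Hj))) => y _.
    by rewrite mulNr mulrN.
  by rewrite mulrNN.
(* This is the image of f_J - alpha - J beta under w |-> w_k - i (J w)_k; the sum over j is i times
   the matrix of J applied to alpha + i beta. *)
have H := hol_add HJ (hol_add (hol_scale (-1) Hk) Hs).
have [x0 Dx0] := real_point.
have zero (x : R) : D (x, 0) -> nsq
    (fun z => ocoord k (slice_fun J f z) + (-1 * alpha k z + \sum_j M j * - beta j z))
    (fun z => - ocoord k (omul J (slice_fun J f z)) +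
       (-1 * beta k z + \sum_j M j * alpha j z)) (x, 0) = 0.
  move=> _; apply/nsq_eq0; rewrite /slice_fun slice_point_real.
  have [-> ->] := stem_real k x; rewrite mulN1r mulr0 add0r; split.
    rewrite big1 ?addr0 ?subrr// => j _.
    by have [_ ->] := stem_real j x; rewrite oppr0 mulr0.
  rewrite ocoord_omul addrC; apply/eqP; rewrite subr_eq0; apply/eqP.
  by apply: eq_bigr => j _; have [-> _] := stem_real j x.
have /nsq_eq0[+ _] := hol_identity_real oD cD H Dx0 zero Dz.
rewrite ocoordD ocoord_omk ocoord_omul => /eqP.
rewrite addr_eq0 mulN1r opprD opprK => /eqP ->; congr (_ + _).
by rewrite -sumrN; apply: eq_bigr => j _; rewrite ocoord_omk mulrN opprK.
Qed.

(* The squared (complex bilinear) norm of alpha + i beta - q, whose zeros are the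
   spheres x + y S on which f takes the value q. *)
Definition norm_re q z : R := \sum_k ((alpha k z + - ocoord k q) *
  (alpha k z + - ocoord k q) - beta k z * beta k z).

Definition norm_im q z : R := \sum_k ((alpha k z + - ocoord k q) * beta k z +
  beta k z * (alpha k z + - ocoord k q)).

Lemma hol_stemB q k : exists a b,
  hol D (fun z => alpha k z + - ocoord k q) (beta k) a b.
Proof.
have [a [b H]] := hol_stem k.
do 2 eexists; apply: (hol_eq oD _ _ (hol_add H (@hol_cst R D (- ocoord k q) 0))) => z _ //.
by rewrite addr0.
Qed.

(** A sum of eight squares of holomorphic functions; the products in [norm_re] and [norm_im] are
    left in the shape that [hol_mul] produces. *)
Lemma hol_norm q : exists a b, hol D (norm_re q) (norm_im q) a b.
Proof.
apply: hol_bigsum => k; have [a [b H]] := hol_stemB q k.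
by do 2 eexists; exact: (hol_mul oD H H).
Qed.

Lemma norm_eq0 q z : D z -> nsq (norm_re q) (norm_im q) z = 0 <->
  exists2 J, imaginary_units J & slice_fun J f z = q.
Proof.
move=> Dz; pose a := omk (alpha ^~ z) - q; pose b := omk (beta ^~ z).
have Ere : norm_re q z = odot a a - odot b b.
  rewrite /norm_re /odot -sumrB; apply: eq_bigr => k _.
  by rewrite /a /b ocoordB !ocoord_omk.
have Eim : norm_im q z = odot a b *+ 2.
  rewrite /norm_im /odot -sumrMnl; apply: eq_bigr => k _.
  by rewrite /a /b ocoordB !ocoord_omk mulr2n [X in _ + X]mulrC.
have E J : imaginary_units J -> slice_fun J f z - q = a + omul J b.
  by move=> JU; rewrite (representation JU Dz) /a /b addrAC.
split.
  move=> /nsq_eq0[]; rewrite Ere Eim => /eqP; rewrite subr_eq0 => /eqP ab /eqP.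
  rewrite mulrn_eq0 /= => /eqP /(orthogonal_unit ab)[J JU ab0].
  by exists J => //; apply/eqP; rewrite -subr_eq0 E// ab0.
move=> [J JU Jq]; have : a + omul J b = 0 by rewrite -E// Jq subrr.
move=> /(unit_orthogonal JU)[ab ab0]; apply/nsq_eq0.
by rewrite Ere Eim ab ab0 subrr mul0rn.
Qed.

(** Off the real axis a sum of complex squares can vanish without its terms vanishing. On the axis
    the terms are real, so each coordinate of the stem function minus q is zero there, and then on
    all of [D] by the identity principle. *)
Lemma norm_eq0_constant q :
  (forall z, D z -> nsq (norm_re q) (norm_im q) z = 0) -> constant_on Omega f.
Proof.
move=> N0; exists q => w Ow.
have [x0 Dx0] := real_point.
have stem0 k z : D z -> alpha k z = ocoord k q /\ beta k z = 0.
  move=> Dz; have [a [b H]] := hol_stemB q k.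
  have zero (x : R) : D (x, 0) ->
      nsq (fun z => alpha k z + - ocoord k q) (beta k) (x, 0) = 0.
    move=> Dx; have [_ bx] := stem_real k x.
    have /nsq_eq0[+ _] := N0 _ Dx; rewrite /norm_re.
    under eq_bigr do rewrite (stem_real _ x).2 mulr0 subr0 -expr2.
    move=> /eqP; rewrite psumr_eq0; last by move=> j _; exact: sqr_ge0.
    move=> /allP /(_ k); rewrite mem_index_enum => /(_ isT).
    by rewrite sqrf_eq0 => /eqP ak; apply/nsq_eq0.
  have /nsq_eq0[/eqP + ->] := hol_identity_real oD cD H Dx0 zero Dz.
  by rewrite subr_eq0 => /eqP.
have [J [x [y [JU wE]]]] := slice_pointP w.
have Dxy : D (x, y) by apply: (sO JU IU); rewrite -wE.
rewrite wE -[LHS]/(slice_fun J f (x, y)) (representation JU Dxy).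
apply: ocoord_inj => k; rewrite ocoordD ocoord_omk (stem0 k _ Dxy).1 ocoord_omul.
by rewrite big1 ?addr0// => j _; rewrite ocoord_omk (stem0 j _ Dxy).2 mulr0.
Qed.

Lemma norm_continuous q z : D z ->
  {for (z, q), continuous (fun y : plane * O => nsq (norm_re y.2) (norm_im y.2) y.1)}.
Proof.
move=> Dz.
have h1 : {for (z, q), continuous (fun y : plane * O => y.1)} by exact: fst_continuous.
have h2 : {for (z, q), continuous (fun y : plane * O => y.2)} by exact: snd_continuous.
have ca k : {for (z, q), continuous (fun y : plane * O => alpha k y.1 + - ocoord k y.2)}.
  have [a [b H]] := hol_stem k; have [cu _] := hol_continuous oD H Dz.
  have h3 := comp_continuous h1 cu.
  have h4 := comp_continuous h2 (@ocoord_continuous R k _).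
  exact: (real_continuousD h3 (real_continuousN h4)).
have cb k : {for (z, q), continuous (fun y : plane * O => beta k y.1)}.
  have [a [b H]] := hol_stem k; have [_ cv] := hol_continuous oD H Dz.
  exact: (comp_continuous h1 cv).
have cre : {for (z, q), continuous (fun y : plane * O => norm_re y.2 y.1)}.
  apply: real_continuous_sum => k.
  exact: (real_continuousB (real_continuousM (ca k) (ca k))
    (real_continuousM (cb k) (cb k))).
have cim : {for (z, q), continuous (fun y : plane * O => norm_im y.2 y.1)}.
  apply: real_continuous_sum => k.
  exact: (real_continuousD (real_continuousM (ca k) (cb k))
    (real_continuousM (cb k) (ca k))).
exact: (real_continuousD (real_continuousM cre cre) (real_continuousM cim cim)).
Qed.

Lemma open_image (U : set O) : ~ constant_on Omega f -> open U ->
  U `<=` Omega -> axially_symmetric U -> open (f @` U).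
Proof.
move=> nc oU UO sU; rewrite openE => c [w Uw fwc].
have [J [x [y [JU wE]]]] := slice_pointP w.
pose z0 : plane := (x, y).
have Uz0 : slice_set I U z0 by apply: (sU _ _ J I) => //; rewrite -wE.
have UD : slice_set I U `<=` D by move=> z; exact: UO.
have Dz0 := UD _ Uz0.
have N0 : nsq (norm_re c) (norm_im c) z0 = 0.
  by apply/(norm_eq0 _ Dz0); exists J => //; rewrite /slice_fun -wE.
have [a [b HN]] := hol_norm c.
have [flat|isolated] := hol_zero_dichotomy oD HN Dz0.
  by case: nc; apply: norm_eq0_constant; exact: hol_identity oD cD HN Dz0 flat.
have oUI : open (slice_set I U) by exact: open_slice_set.
(* Persistence is applied on the slice of [U] rather than of [Omega], so that the zeros found for
   nearby [q] stay over [U]. *)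
have HU q : exists a b, hol (slice_set I U) (norm_re q) (norm_im q) a b.
  by have [a' [b' Hq]] := hol_norm q; exists a', b'; exact: hol_sub UD Hq.
have cU z (Uz : slice_set I U z) := @norm_continuous c z (UD z Uz).
have := @hol_zero_persists R O c (slice_set I U) norm_re norm_im z0 oUI HU Uz0 cU
  N0 isolated.
apply: filterS => q [z Uz /(norm_eq0 _ (UD z Uz))[K KU fq]].
(* The unit [K] depends on [q] and need not be [I]; axial symmetry of [U] moves the point from the
   slice of [I] to that of [K]. *)
by exists (slice_point K z) => //; case: z Uz {fq} => s t; exact: sU.
Qed.

End OpenMapping.

Theorem theorem1p8 (R : realType) (Omega : set (octonion R))
    (f : octonion R -> octonion R) :
  symmetric_slice_domain Omega ->
  slice_regular Omega f ->
  ~ constant_on Omega f ->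
  (forall U : set (octonion R),
      open U -> U `<=` Omega -> axially_symmetric U -> open (f @` U)) /\
  open (f @` Omega).
Proof.
move=> ssd sr nc; have [I IU] := @exists_imaginary_unit R.
have H U := @open_image R Omega f I ssd sr IU U nc.
by have [[_ oO _] sO _ _] := ssd; split => //; exact: H.
Qed.
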